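(* Let $\mu_0>0$ and $\varepsilon_0\in(0,\delta)$. For every $\varepsilon\in(0,\varepsilon_0)$ let $u=u^\varepsilon$ (an $\mathbb{R}^3$-valued function) and $p=p^\varepsilon$ (a scalar function) be smooth on $\overline{Q_{\varepsilon,T}}$ and satisfy the incompressible Navier-Stokes equations with perfect slip boundary condition in the moving thin domain $\Omega_\varepsilon(t)$: $$\partial_t u+(u\cdot\nabla)u+\nabla p=\mu_0\Delta u,\quad \mathrm{div}\,u=0\quad\text{in } Q_{\varepsilon,T},$$ $$u\cdot\nu_\varepsilon=V_\varepsilon^N,\quad [D(u)\nu_\varepsilon]_{\mathrm{tan}}=0\quad\text{on }\partial_\ell Q_{\varepsilon,T}.$$ Suppose that $u$ and $p$ admit expansions in powers of the signed distance, with coefficients $v,v^1,v^2,q,q^1,\dots$ on $S_T$ independent of $\varepsilon$, $$u(x,t)=v(\pi(x,t),t)+d(x,t)\,v^1(\pi(x,t),t)+d(x,t)^2v^2(\pi(x,t),t)+R(d(x,t)^3),$$ $$p(x,t)=q(\pi(x,t),t)+d(x,t)\,q^1(\pi(x,t),t)+R(d(x,t)^2).$$ Then $v\cdot\nu=V_\Gamma^N$ on $S_T$, and $v$, $q$, $q^1$ satisfy $$\partial^\bullet_v v+\nabla_\Gamma q+q^1\nu=2\mu_0\,\mathrm{div}_\Gamma(P_\Gamma D^{tan}(v)P_\Gamma)\quad\text{on } S_T,\qquad \mathrm{div}_\Gamma v=0\quad\text{on } S_T.$$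
   Context: Geometry. Let $T>0$ and let $\Gamma(t)$, $t\in[0,T]$, be a two-dimensional closed (compact, without boundary), connected, oriented, smooth surface in $\mathbb{R}^3$ moving smoothly in $t$ (without change of topology), with unit outward normal $\nu(\cdot,t)$ and scalar outward normal velocity $V_\Gamma^N(\cdot,t)$. Put $S_T=\bigcup_{t\in(0,T)}\Gamma(t)\times\{t\}$. Fix $\delta>0$ independent of $t$ such that every $x\in N(t)=\{x\in\mathbb{R}^3: \mathrm{dist}(x,\Gamma(t))<\delta\}$ is uniquely written as $x=\pi(x,t)+d(x,t)\nu(\pi(x,t),t)$, where $\pi(\cdot,t)$ is the closest point mapping onto $\Gamma(t)$ and $d(\cdot,t)$ is the signed distance from $\Gamma(t)$, increasing in the direction of $\nu$; $\pi$ and $d$ are smooth on the closure of $N_T=\bigcup_{t\in(0,T)}N(t)\times\{t\}$. For $0<\varepsilon<\delta$ let $\Omega_\varepsilon(t)=\{x: \mathrm{dist}(x,\Gamma(t))<\varepsilon\}$, $Q_{\varepsilon,T}=\bigcup_{t\in(0,T)}\Omega_\varepsilon(t)\times\{t\}$, $\partial_\ell Q_{\varepsilon,T}=\bigcup_{t\in(0,T)}\partial\Omega_\varepsilon(t)\times\{t\}$. The unit outward normal and scalar outward normal velocity of $\partial\Omega_\varepsilon(t)$ are $\nu_\varepsilon(x,t)=\pm\nu(\pi(x,t),t)$ and $V_\varepsilon^N(x,t)=\pm V_\Gamma^N(\pi(x,t),t)$ where $d(x,t)=\pm\varepsilon$. All functions are assumed sufficiently smooth (up to the closure of their domains). Operators.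 The gradient matrix of a vector field $F$ is $(\nabla F)_{ij}=\partial_iF_j$; $D(u)=\{\nabla u+(\nabla u)^T\}/2$; $[a]_{\mathrm{tan}}$ is the component of $a\in\mathbb{R}^3$ tangential to $\partial\Omega_\varepsilon(t)$. $P_\Gamma=I_3-\nu\otimes\nu$; for a function $f$ on $\Gamma(t)$ with any extension $\tilde f$ to $N(t)$, $\nabla_\Gamma f=P_\Gamma\nabla\tilde f=(\partial_1^{tan}f,\partial_2^{tan}f,\partial_3^{tan}f)$ (independent of the extension). For a vector field $G$ and a $3\times3$ matrix-valued function $M$ on $\Gamma(t)$: $(\nabla_\Gamma G)_{ij}=\partial_i^{tan}G_j$, $\mathrm{div}_\Gamma G=\sum_i\partial_i^{tan}G_i$, $[\mathrm{div}_\Gamma M]_j=\sum_i\partial_i^{tan}M_{ij}$, and $D^{tan}(v)=\{\nabla_\Gamma v+(\nabla_\Gamma v)^T\}/2$. For a vector field $v$ on $S_T$ with $v\cdot\nu=V_\Gamma^N$, the material derivative of a (scalar or vector) function $f$ on $S_T$ is $\partial_v^\bullet f=\partial_t\tilde f+(v\cdot\nabla)\tilde f$ on $S_T$, where $\tilde f$ is any extension of $f$ to $N_T$ (independent of the extension). Expansions. To say that $f=f^\varepsilon$ on $Q_{\varepsilon,T}$ admits the expansion $f=g(\pi,t)+d\,g^1(\pi,t)+d^2g^2(\pi,t)+\cdots$ means that $g,g^1,g^2,\dots$ are smooth functions on $S_T$ (up to its closure) independent of $\varepsilon$, and for each $k\in\mathbb{N}$ one has $f(x,t)=\sum_{j=0}^{k-1}d(x,t)^jg^j(\pi(x,t),t)+R(d(x,t)^k)$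 (with $g^0=g$), where $R(d^k)$ denotes the terms of order at least $k$ in $d$. The remainder may be differentiated in $x$ and $t$: its derivatives of order $l\le k$ are $R(d^{k-l})$, in particular bounded in absolute value by $C|d(x,t)|^{k-l}$ with $C$ independent of $\varepsilon$ and $(x,t)$. *)

(* Defs.v *)
From HB Require Import structures.
From mathcomp Require Export all_boot all_order all_algebra.
From mathcomp Require Export all_classical all_reals all_analysis.
Export Order.TTheory GRing.Theory Num.Theory.
Export numFieldNormedType.Exports.

#[export] Set Implicit Arguments.
#[export] Unset Strict Implicit.
#[export] Unset Printing Implicit Defensive.

Open Scope classical_set_scope.
Open Scope ring_scope.

(* Vectors of R^3 are columns; time-dependent objects are uncurried functions
   of z = (x, t).  The norm `|_| on these types is the sup norm, which is only
   used for the topology and for bounds up to a constant; the Euclidean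
   structure is dot / enorm / dist. *)
Notation vec R := 'cV[R]_3.
Notation spacetime R := ('cV[R]_3 * R)%type.

Definition dot {R : realType} (a b : vec R) : R := \sum_(i < 3) a i 0 * b i 0.

Definition enorm {R : realType} (a : vec R) : R := Num.sqrt (dot a a).

Definition dist {R : realType} (x : vec R) (A : set (vec R)) : R :=
  inf [set enorm (x - y) | y in A].

Definition boundary {X : topologicalType} (A : set X) : set X :=
  closure A `\` interior A.

(* ** Smoothness *)

(* C^n on a set A, which is open in every use. *)
Fixpoint Ck {R : realType} {X Y : normedModType R} (n : nat) (A : set X)
    (f : X -> Y) : Prop :=
  if n is m.+1 then
    (forall x, A x -> differentiable f x) /\
    (forall e : X, Ck m A (fun x => 'D_e f x))
  else forall x, A x -> {for x, continuous f}.

Definition Cinf {R : realType} {X Y : normedModType R} (A : set X)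
    (f : X -> Y) : Prop := forall n, Ck n A f.

(* The total function f is itself smooth across A, so that its derivatives are
   meaningful at every point of A, boundary points included. *)
Definition smooth_near {R : realType} {X Y : normedModType R} (A : set X)
    (f : X -> Y) : Prop :=
  exists W : set X, [/\ open W, A `<=` W & Cinf W f].

(* Smoothness of a function on an arbitrary subset (a surface, the closure of an
   open set): only the values of f on A matter. *)
Definition smooth_on {R : realType} {X Y : normedModType R} (A : set X)
    (f : X -> Y) : Prop :=
  exists g : X -> Y, smooth_near A g /\ (forall x, A x -> f x = g x).

(* ** Differential operators in space-time *)

Definition dirx {R : realType} (i : 'I_3) : spacetime R := (delta_mx i 0, 0).

Definition dirt {R : realType} : spacetime R := (0, 1).

Definition pdx {R : realType} {Y : normedModType R} (i : 'I_3)
    (f : spacetime R -> Y) (z : spacetime R) : Y := 'D_(dirx i) f z.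

Definition pdt {R : realType} {Y : normedModType R}
    (f : spacetime R -> Y) (z : spacetime R) : Y := 'D_dirt f z.

Definition grad {R : realType} (f : spacetime R -> R) (z : spacetime R) : vec R :=
  \col_i pdx i f z.

Definition gradv {R : realType} (F : spacetime R -> vec R) (z : spacetime R) :
    'M[R]_3 :=
  \matrix_(i, j) pdx i (fun z' => F z' j 0) z.

Definition strain {R : realType} (F : spacetime R -> vec R) (z : spacetime R) :
    'M[R]_3 :=
  2^-1 *: (gradv F z + (gradv F z)^T).

Definition divergence {R : realType} (F : spacetime R -> vec R)
    (z : spacetime R) : R :=
  \sum_(i < 3) pdx i (fun z' => F z' i 0) z.

Definition laplacian {R : realType} (F : spacetime R -> vec R)
    (z : spacetime R) : vec R :=
  \col_j \sum_(i < 3) pdx i (pdx i (fun z' => F z' j 0)) z.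

(* (a . nabla) F *)
Definition advect {R : realType} (a : vec R) (F : spacetime R -> vec R)
    (z : spacetime R) : vec R :=
  \col_j \sum_(i < 3) a i 0 * pdx i (fun z' => F z' j 0) z.

(* ** Moving closed surfaces *)

Definition smooth_surface {R : realType} (G : set (vec R)) : Prop :=
  forall y, G y -> exists (U : set (vec R)) (phi : vec R -> R),
    [/\ open U, U y, Cinf U phi,
        (forall x, U x -> exists i : 'I_3, 'D_(delta_mx i 0) phi x != 0) &
        (forall x, U x -> (G x <-> phi x = 0))].

Definition closed_surface {R : realType} (G : set (vec R)) : Prop :=
  [/\ G !=set0, compact G, connected G & smooth_surface G].

(* The union over t in J of A t x {t}. *)
Definition tube {R : realType} (J : set R) (A : R -> set (vec R)) :
    set (spacetime R) :=
  [set z | J z.2 /\ A z.2 z.1].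

(* The surfaces Gam t are the images of Gam 0 under a smooth family Phi(., t) of
   diffeomorphisms, with inverses Psi(., t). *)
Definition moves_smoothly {R : realType} (T : R) (Gam : R -> set (vec R)) : Prop :=
  exists Phi Psi : spacetime R -> vec R,
    [/\ smooth_on (tube `[0, T] (fun _ => Gam 0)) Phi,
        smooth_on (tube `[0, T] Gam) Psi,
        (forall X, Gam 0 X -> Phi (X, 0) = X),
        (forall (t : R) X, 0 <= t <= T -> Gam 0 X ->
          Gam t (Phi (X, t)) /\ Psi (Phi (X, t), t) = X) &
        (forall (t : R) y, 0 <= t <= T -> Gam t y ->
          Gam 0 (Psi (y, t)) /\ Phi (Psi (y, t), t) = y)].

Definition moving_surface {R : realType} (T : R) (Gam : R -> set (vec R)) : Prop :=
  (forall t : R, 0 <= t <= T -> closed_surface (Gam t)) /\ moves_smoothly T Gam.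

Definition tangent_vector {R : realType} (G : set (vec R)) (y w : vec R) : Prop :=
  exists c : R -> vec R,
    [/\ smooth_near [set 0] c, (\forall s \near 0, G (c s)), c 0 = y &
        'D_1 c 0 = w].

(* The points enclosed by G. *)
Definition inside {R : realType} (G : set (vec R)) : set (vec R) :=
  [set x | ~ G x /\ bounded_set (connected_component (~` G) x)].

Record outward_unit_normal {R : realType} (T : R) (Gam : R -> set (vec R))
    (nu : spacetime R -> vec R) : Prop := {
  normal_smooth : smooth_on (closure (tube `]0, T[ Gam)) nu ;
  normal_unit : forall (t : R) y, 0 <= t <= T -> Gam t y -> enorm (nu (y, t)) = 1 ;
  normal_orth : forall (t : R) y w, 0 <= t <= T -> Gam t y ->
    tangent_vector (Gam t) y w -> dot w (nu (y, t)) = 0 ;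
  normal_outward : forall (t : R) y, 0 <= t <= T -> Gam t y ->
    \forall s \near 0^'+,
      inside (Gam t) (y - s *: nu (y, t)) /\
      (~` Gam t `\` inside (Gam t)) (y + s *: nu (y, t))
}.

(* The normal component of the velocity of any curve carried by the moving
   surface; moves_smoothly provides such a curve through each point of S_T. *)
Definition normal_velocity {R : realType} (T : R) (Gam : R -> set (vec R))
    (nu : spacetime R -> vec R) (VN : spacetime R -> R) : Prop :=
  forall (t : R) (c : R -> vec R), 0 < t < T -> smooth_near [set t] c ->
    (\forall s \near t, Gam s (c s)) ->
    VN (c t, t) = dot ('D_1 c t) (nu (c t, t)).

Definition tubular_nbhd {R : realType} (r : R) (Gam : R -> set (vec R)) (t : R) :
    set (vec R) :=
  [set x | dist x (Gam t) < r].

(* proj_closest, proj_decomp and normal_unit give |d| = dist(., Gam t), and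
   proj_decomp makes d positive on the side nu points to. *)
Record tubular_coordinates {R : realType} (T delta : R) (Gam : R -> set (vec R))
    (nu : spacetime R -> vec R) (proj : spacetime R -> vec R)
    (d : spacetime R -> R) : Prop := {
  proj_on : forall (t : R) x, 0 <= t <= T -> tubular_nbhd delta Gam t x ->
    Gam t (proj (x, t)) ;
  proj_closest : forall (t : R) x, 0 <= t <= T -> tubular_nbhd delta Gam t x ->
    enorm (x - proj (x, t)) = dist x (Gam t) ;
  proj_decomp : forall (t : R) x, 0 <= t <= T -> tubular_nbhd delta Gam t x ->
    x = proj (x, t) + d (x, t) *: nu (proj (x, t), t) ;
  proj_unique : forall (t : R) x y (s : R), 0 <= t <= T -> tubular_nbhd delta Gam t x ->
    Gam t y -> `|s| < delta -> x = y + s *: nu (y, t) ->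
    y = proj (x, t) /\ s = d (x, t) ;
  proj_smooth :
    smooth_on (closure (tube `]0, T[ (tubular_nbhd delta Gam))) proj ;
  d_smooth : smooth_on (closure (tube `]0, T[ (tubular_nbhd delta Gam))) d
}.

(* ** Operators on the moving surface *)

(* The extension, constant in the normal direction, of a function on S_T; the
   tangential and material derivatives below do not depend on the extension. *)
Definition ext {R : realType} {Y : Type} (proj : spacetime R -> vec R)
    (f : spacetime R -> Y) (z : spacetime R) : Y :=
  f (proj z, z.2).

Definition PGam {R : realType} (nu : spacetime R -> vec R) (z : spacetime R) :
    'M[R]_3 :=
  1%:M - nu z *m (nu z)^T.

Definition tgrad {R : realType} (nu proj : spacetime R -> vec R)
    (f : spacetime R -> R) (z : spacetime R) : vec R :=
  PGam nu z *m grad (ext proj f) z.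

Definition pdtan {R : realType} (nu proj : spacetime R -> vec R) (i : 'I_3)
    (f : spacetime R -> R) (z : spacetime R) : R :=
  tgrad nu proj f z i 0.

Definition tgradv {R : realType} (nu proj : spacetime R -> vec R)
    (G : spacetime R -> vec R) (z : spacetime R) : 'M[R]_3 :=
  \matrix_(i, j) pdtan nu proj i (fun z' => G z' j 0) z.

Definition tdiv {R : realType} (nu proj : spacetime R -> vec R)
    (G : spacetime R -> vec R) (z : spacetime R) : R :=
  \sum_(i < 3) pdtan nu proj i (fun z' => G z' i 0) z.

Definition tdivm {R : realType} (nu proj : spacetime R -> vec R)
    (M : spacetime R -> 'M[R]_3) (z : spacetime R) : vec R :=
  \col_j \sum_(i < 3) pdtan nu proj i (fun z' => M z' i j) z.

Definition tstrain {R : realType} (nu proj : spacetime R -> vec R)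
    (v : spacetime R -> vec R) (z : spacetime R) : 'M[R]_3 :=
  2^-1 *: (tgradv nu proj v z + (tgradv nu proj v z)^T).

Definition material_derivative {R : realType} (proj : spacetime R -> vec R)
    (v f : spacetime R -> vec R) (z : spacetime R) : vec R :=
  pdt (ext proj f) z + advect (v z) (ext proj f) z.

(* ** Expansions in powers of the signed distance *)

(* None stands for the time direction. *)
Definition iter_pd {R : realType} {Y : normedModType R} (s : seq (option 'I_3))
    (f : spacetime R -> Y) : spacetime R -> Y :=
  foldr (fun o g => if o is Some i then pdx i g else pdt g) f s.

(* The family r eps on Q_{eps,T} is R(d^k): derivatives of order l <= k in (x, t)
   are bounded by C |d|^(k-l), uniformly in eps. *)
Definition remainder {R : realType} {Y : normedModType R} (T eps0 : R)
    (Gam : R -> set (vec R)) (d : spacetime R -> R) (k : nat)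
    (r : R -> spacetime R -> Y) : Prop :=
  exists C : R, forall (eps : R) (z : spacetime R) (s : seq (option 'I_3)),
    0 < eps < eps0 -> tube `]0, T[ (tubular_nbhd eps Gam) z -> (size s <= k)%N ->
    `|iter_pd s (r eps) z| <= C * `|d z| ^+ (k - size s).

(* f eps = \sum_(j < k) d^j g_j(proj, t) + R(d^k) *)
Definition expansion {R : realType} {Y : normedModType R} (T eps0 : R)
    (Gam : R -> set (vec R)) (proj : spacetime R -> vec R) (d : spacetime R -> R)
    (k : nat) (f : R -> spacetime R -> Y) (g : 'I_k -> spacetime R -> Y) : Prop :=
  (forall j, smooth_on (closure (tube `]0, T[ Gam)) (g j)) /\
  remainder T eps0 Gam d k
    (fun eps z => f eps z - \sum_(j < k) d z ^+ j *: ext proj (g j) z).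

(* ** Navier-Stokes equations with perfect slip in the moving thin domain *)

(* Outward normal and outward normal velocity of the boundary of Omega_eps(t),
   where d = eps or d = - eps. *)
Definition nu_eps {R : realType} (nu proj : spacetime R -> vec R)
    (d : spacetime R -> R) (z : spacetime R) : vec R :=
  Num.sg (d z) *: nu (proj z, z.2).

Definition VN_eps {R : realType} (VN : spacetime R -> R)
    (proj : spacetime R -> vec R) (d : spacetime R -> R) (z : spacetime R) : R :=
  Num.sg (d z) * VN (proj z, z.2).

Definition tan_part {R : realType} (n a : vec R) : vec R := a - dot a n *: n.

Record navier_stokes_slip {R : realType} (T mu0 eps : R)
    (Gam : R -> set (vec R)) (nu : spacetime R -> vec R) (VN : spacetime R -> R)
    (proj : spacetime R -> vec R) (d : spacetime R -> R)
    (u : spacetime R -> vec R) (p : spacetime R -> R) : Prop := {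
  ns_momentum : forall z, tube `]0, T[ (tubular_nbhd eps Gam) z ->
    pdt u z + advect (u z) u z + grad p z = mu0 *: laplacian u z ;
  ns_incompressible : forall z, tube `]0, T[ (tubular_nbhd eps Gam) z ->
    divergence u z = 0 ;
  ns_impermeable : forall z,
    tube `]0, T[ (fun t => boundary (tubular_nbhd eps Gam t)) z ->
    dot (u z) (nu_eps nu proj d z) = VN_eps VN proj d z ;
  ns_slip : forall z,
    tube `]0, T[ (fun t => boundary (tubular_nbhd eps Gam t)) z ->
    tan_part (nu_eps nu proj d z) (strain u z *m nu_eps nu proj d z) = 0
}.

(* Main.v *)
From mathcomp Require Import ring.
Require Import Defs.

(* Put U = v(pi, t) + d v1(pi, t) + d^2 v2(pi, t), and let n be the normal,
   extended constantly along itself.  At the outer boundary point y + s n with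
   s = eps, impermeability says that the polynomial U.n - V_Gamma^N of degree
   two in s is O(s^3); hence U.n = V_Gamma^N along the whole ray and
   n.D(U)n = 0.  The slip condition then gives D(U)n = O(s^2), and
   incompressibility gives div U = O(s^2), so D(U)n and div U vanish on the
   surface together with their normal derivatives.  Consequently
   P D^tan(v) P = D(U) on the surface, and there
     2 div_Gamma D(U) = Laplace U + grad (div U) - 2 d_n (D(U)n) = Laplace U.
   It remains to read the momentum equation on the surface, where u and U agree
   to second order, using d_i pi_k = delta_ik - n_i n_k and
   d_t pi = V_Gamma^N n there. *)

(** For a given thickness [eps] the boundary conditions hold only at the height s = [eps] of a ray.
    They become estimates along a ray only by letting [eps] vary, which is possible because U does
    not depend on [eps] and the remainder constants are uniform in it. The equations in the bulk are
    used for one fixed thickness. The slip condition controls only the tangential part of D(u)n. The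
    missing normal part is supplied by U.n being exactly constant along rays; an estimate of U.n on
    the surface alone would not give it. The order of the expansion is what the argument consumes:
    R(d^3) leaves O(s^2) after one derivative, enough for a value and a normal derivative to vanish,
    and leaves O(s) after two, enough to identify the Laplacian on the surface. The coefficients are
    controlled only through their values on the surface, so derivatives are taken of U or of
    extensions constant along normals, which are smooth on the open tube. The normal is frozen at
    the foot point of each ray, so its own derivatives never enter. *)

(** * Locality of differentiability and the chain rule *)

Section Differentiability.
Context {R : realType}.

(** The first-order expansion of [f] at [x] is also one for [g]. Since ['d g x] is a chosen
    function, uniqueness of the differential is needed to identify it with ['d f x]. *)
Lemma near_eq_differentiable (X Y : normedModType R) (f g : X -> Y) (x : X) :
  {near x, f =1 g} -> differentiable f x -> differentiable g x.
Proof.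
move=> fg df; have fgx : f x = g x := nbhs_singleton fg.
have h : g \o shift x = cst (g x) + 'd f x +o_ 0 id.
  have := diff_locally df => /eqaddoP ho.
  have fg0 : \forall y \near 0, f (y + x) = g (y + x).
    have : (fun y : X => y + x) @ (0 : X) --> x.
      rewrite -[X in _ --> X]add0r.
      by apply: cvgD; [exact: cvg_id|exact: cvg_cst].
    by move/(_ _ fg).
  apply/eqaddoP => e e0; have := ho e e0; apply: filterS2 fg0.
  by move=> y /= ygs; rewrite !fctE /= fgx ygs.
have dgE := diff_unique (diff_continuous df) h.
apply/diff_locallyP; split; last by rewrite dgE.
by rewrite dgE; exact: diff_continuous.
Qed.

Lemma derive_chain (X Y Z : normedModType R) (F : X -> Y) (f : Y -> Z)
    (x e : X) :
  differentiable F x -> differentiable f (F x) ->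
  'D_e (f \o F) x = 'D_('D_e F x) f (F x).
Proof.
move=> dF df; rewrite deriveE; last exact: differentiable_comp.
by rewrite diff_comp //= (deriveE _ dF) (deriveE _ df).
Qed.

End Differentiability.

(** * Calculus of the classes C^n on open sets *)

Section CkTheory.
Context {R : realType}.

Lemma open_near (X : normedModType R) (A : set X) (P : X -> Prop) x :
  open A -> A x -> (forall y, A y -> P y) -> \forall y \near x, P y.
Proof. by move=> oA Ax AP; apply: filterS (open_nbhs_nbhs (conj oA Ax)). Qed.

(** Openness makes the induction work: equality on a neighbourhood gives equal derivatives. The sum,
    product and composition rules for derivatives are known only on [A], so most closure properties
    below pass through this lemma. *)
Lemma Ck_eq (X Y : normedModType R) n (A : set X) (f g : X -> Y) :
  open A -> (forall x, A x -> f x = g x) -> Ck n A f -> Ck n A g.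
Proof.
move=> oA; elim: n f g => [|n IHn] f g fg /=.
  move=> cf x Ax; have fgx : \forall y \near x, f y = g y.
    exact: open_near Ax fg.
  rewrite /prop_for /continuous_at -(fg _ Ax).
  exact: cvg_trans (near_eq_cvg fgx) (cf x Ax).
move=> [df Ckf]; split=> [x Ax|e].
  by apply: near_eq_differentiable (df x Ax); exact: open_near Ax fg.
apply: IHn (Ckf e) => x Ax; apply: near_eq_derive; exact: open_near Ax fg.
Qed.

Lemma Ck_subset (X Y : normedModType R) n (A B : set X) (f : X -> Y) :
  B `<=` A -> Ck n A f -> Ck n B f.
Proof.
move=> BA; elim: n f => [|n IHn] f /=; first by move=> cf x /BA; exact: cf.
by move=> [df Ckf]; split=> [x /BA|e]; [exact: df|exact: IHn].
Qed.

Lemma CkW (X Y : normedModType R) n (A : set X) (f : X -> Y) :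
  Ck n.+1 A f -> Ck n A f.
Proof.
elim: n f => [|n IHn] f [df Ckf].
  by move=> x Ax; exact/differentiable_continuous/df.
by split=> // e; exact: IHn.
Qed.

Lemma Ck_cst (X Y : normedModType R) n (A : set X) (c : Y) :
  Ck n A (fun _ : X => c).
Proof.
elim: n c => [|n IHn] c; first by move=> x _; exact: cst_continuous.
split=> [x _|e]; first exact: differentiable_cst.
by have -> : (fun x => 'D_e (fun=> c) x) = (fun _ : X => 0);
  [apply/funext => x; exact: derive_cst|exact: IHn].
Qed.

Lemma CkD (X Y : normedModType R) n (A : set X) (f g : X -> Y) :
  open A -> Ck n A f -> Ck n A g -> Ck n A (fun x => f x + g x).
Proof.
move=> oA; elim: n f g => [|n IHn] f g.
  by move=> cf cg x Ax; apply: continuousD; [exact: cf|exact: cg].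
move=> [df Cf] [dg Cg]; split=> [x Ax|e].
  by apply: differentiableD; [exact: df|exact: dg].
apply: Ck_eq (IHn _ _ (Cf e) (Cg e)) => // x Ax.
by apply/esym/deriveD; apply: diff_derivable; [exact: df|exact: dg].
Qed.

Lemma CkM (X : normedModType R) n (A : set X) (f g : X -> R) :
  open A -> Ck n A f -> Ck n A g -> Ck n A (fun x => f x * g x).
Proof.
move=> oA; elim: n f g => [|n IHn] f g.
  by move=> cf cg x Ax; apply: continuousM; [exact: cf|exact: cg].
move=> Hf Hg; have [df Cf] := Hf; have [dg Cg] := Hg; split=> [x Ax|e].
  by apply: differentiableM; [exact: df|exact: dg].
have := CkD oA (IHn _ _ (CkW Hf) (Cg e)) (IHn _ _ (CkW Hg) (Cf e)).
apply: Ck_eq => // x Ax.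
by apply/esym/deriveM; apply: diff_derivable; [exact: df|exact: dg].
Qed.

Lemma Ck_sum (X Y : normedModType R) n (A : set X) (I : Type) (r : seq I)
    (f : I -> X -> Y) :
  open A -> (forall i, Ck n A (f i)) -> Ck n A (fun x => \sum_(i <- r) f i x).
Proof.
move=> oA Cf; elim: r => [|i r IHr].
  by apply: Ck_eq (Ck_cst n A (0 : Y)) => // x _; rewrite big_nil.
by apply: Ck_eq (CkD oA (Cf i) IHr) => // x _; rewrite big_cons.
Qed.

Lemma CkX (X : normedModType R) n (A : set X) (f : X -> R) m :
  open A -> Ck n A f -> Ck n A (fun x => f x ^+ m).
Proof.
move=> oA Cf; elim: m => [|m IHm].
  by apply: Ck_eq (Ck_cst n A (1 : R)) => // x _; rewrite expr0.
by apply: Ck_eq (CkM oA Cf IHm) => // x _; rewrite exprS.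
Qed.

Lemma CkB (X : normedModType R) n (A : set X) (f g : X -> R) :
  open A -> Ck n A f -> Ck n A g -> Ck n A (fun x => f x - g x).
Proof.
move=> oA Cf Cg.
apply: Ck_eq (CkD oA Cf (CkM oA (Ck_cst n A (-1 : R)) Cg)) => // x _.
by rewrite mulN1r.
Qed.

Lemma differentiable_entry (X : normedModType R) m k (F : X -> 'M[R]_(m, k))
    i j x :
  differentiable F x -> differentiable (fun y => F y i j) x.
Proof.
move=> dF; apply: (@differentiable_comp _ _ _ _ F (fun M => M i j)) => //.
exact: differentiable_coord.
Qed.

Lemma derive_entry (X : normedModType R) m k (F : X -> 'M[R]_(m, k)) i j x e :
  differentiable F x -> ('D_e F x) i j = 'D_e (fun y => F y i j) x.
Proof. by move=> dF; rewrite derive_mx ?mxE //; exact: diff_derivable. Qed.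

Lemma Ck_entry (X : normedModType R) n (A : set X) m k (F : X -> 'M[R]_(m, k))
    i j :
  open A -> Ck n A F -> Ck n A (fun y => F y i j).
Proof.
move=> oA; elim: n F => [|n IHn] F.
  move=> cF x Ax.
  exact: (continuous_comp (cF x Ax) (@coord_continuous R m k i j (F x))).
move=> [dF CF]; split=> [x Ax|e].
  by apply: differentiable_entry; exact: dF.
by apply: Ck_eq (IHn _ (CF e)) => // x Ax; apply: derive_entry; exact: dF.
Qed.

(** The two difference quotients are the same function, so no differentiability is required. *)
Lemma derive_affine (X Y : normedModType R) (f : X -> Y) (z w : X) (s e : R) :
  'D_e (fun s' : R => f (z + s' *: w)) s = 'D_(e *: w) f (z + s *: w).
Proof.
rewrite /derive; set F := (F in lim (F @ _)); set G := (G in _ = lim (G @ _)).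
suff -> : F = G by [].
by apply/funext => h; rewrite /F /G /= addrCA scalerDl scalerA.
Qed.

Lemma differentiable_affine (X : normedModType R) (z w : X) (s : R) :
  differentiable (fun s' : R => z + s' *: w) s.
Proof.
by apply: differentiableD; [exact: differentiable_cst|exact: differentiableZl].
Qed.

Lemma affine_continuous (X : normedModType R) (z w : X) :
  continuous (fun s' : R => z + s' *: w).
Proof. by move=> s; exact/differentiable_continuous/differentiable_affine. Qed.

Lemma Ck_affine (X Y : normedModType R) n (A : set X) (f : X -> Y) (z w : X) :
  open A -> Ck n A f ->
  Ck n ((fun s : R => z + s *: w) @^-1` A) (fun s => f (z + s *: w)).
Proof.
move=> oA; elim: n f => [|n IHn] f.
  move=> cf s As.
  exact: (continuous_comp (@affine_continuous X z w s) (cf _ As)).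
move=> [df Cf]; split=> [s As|e].
  apply: (@differentiable_comp R R X Y (fun s : R => z + s *: w) f).
    exact: differentiable_affine.
  exact: df.
suff -> : (fun s => 'D_e (fun s' : R => f (z + s' *: w)) s) =
          (fun s => 'D_(e *: w) f (z + s *: w)) by exact: (IHn _ (Cf (e *: w))).
by apply/funext => s; exact: derive_affine.
Qed.

Lemma open_affine (X : normedModType R) (A : set X) (z w : X) :
  open A -> open ((fun s : R => z + s *: w) @^-1` A).
Proof. by move=> oA; apply: open_comp oA => s _; exact: affine_continuous. Qed.

End CkTheory.

(** * Symmetry of second derivatives *)

Section Schwarz.
Context {R : realType} {X : normedModType R}.

Lemma approx_eq (p q v w h e : R) : (h == 0) = false ->
  w * h * h = v * h * h -> `|p - w| < e / 2 -> `|q - v| < e / 2 ->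
  `|p - q| <= e.
Proof.
move=> /negbT hn0 /(mulIf hn0) /(mulIf hn0) -> c1 c2.
have -> : p - q = (p - v) - (q - v) by ring.
apply: le_trans (ler_normB _ _) _; rewrite [leRHS](splitr e).
by rewrite lerD // ltW.
Qed.

Lemma MVT_affine (f : X -> R) (z w : X) (h : R) :
  0 < h -> (forall s, 0 <= s <= h -> differentiable f (z + s *: w)) ->
  exists2 s, 0 <= s <= h & f (z + h *: w) - f z = 'D_w f (z + s *: w) * h.
Proof.
move=> h0 df; pose g s := f (z + s *: w).
have dg s : 0 <= s <= h -> differentiable g s.
  move=> sh; apply: (@differentiable_comp R R X R (fun s : R => z + s *: w) f).
    exact: differentiable_affine.
  exact: df.
have dgE s : 0 <= s <= h -> is_derive s 1 g ('D_w f (z + s *: w)).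
  move=> sh; apply: DeriveDef; first exact/diff_derivable/dg.
  by rewrite /g derive_affine scale1r.
have [//|s||s sh] := @MVT R g (fun s => 'D_w f (z + s *: w)) 0 h.
- by rewrite in_itv => /andP[/ltW ? /ltW ?]; apply: dgE; apply/andP.
- apply: continuous_in_subspaceT => s; rewrite inE /= in_itv /= => sh.
  exact/differentiable_continuous/dg.
rewrite /g subr0 scale0r addr0 => gE; exists s => //.
by move: sh; rewrite in_itv => /andP[/ltW -> /ltW ->].
Qed.

(** The mean value theorem is applied along [a] to the increment f(y + h b) - f(y), then along [b]
    to ['D_a f]. The left side is symmetric in [a] and [b], the right side is not: comparing the two
    orders gives the symmetry. *)
Lemma second_difference (A : set X) (f : X -> R) (x a b : X) (h : R) :
  open A -> Ck 2 A f -> 0 < h ->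
  (forall s t, 0 <= s <= h -> 0 <= t <= h -> A (x + s *: a + t *: b)) ->
  exists s t, [/\ 0 <= s <= h, 0 <= t <= h &
    f (x + h *: a + h *: b) - f (x + h *: a) - (f (x + h *: b) - f x) =
    'D_b ('D_a f) (x + s *: a + t *: b) * h * h].
Proof.
move=> oA [df Cf] h0 hA.
have h0h : 0 <= h <= h by rewrite lexx ltW.
have h00 : 0 <= (0 : R) <= h by rewrite lexx ltW.
pose g y := f (y + h *: b) - f y.
have dfb y : A (y + h *: b) -> differentiable (fun y => f (y + h *: b)) y.
  move=> Ay; apply: (@differentiable_comp R X X R (fun y => y + h *: b) f).
    by apply: differentiableD; [exact: ex_diff|exact: differentiable_cst].
  exact: df.
have shift_derive y : 'D_a (fun y => f (y + h *: b)) y = 'D_a f (y + h *: b).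
  rewrite /derive; set F := (F in lim (F @ _)); set G := (G in _ = lim (G @ _)).
  by suff -> : F = G by []; apply/funext => k; rewrite /F /G /= addrA.
have [//|s sh|s sh gE] := @MVT_affine g x a h.
  apply: differentiableB; first by apply: dfb; exact: hA.
  by apply: df; have := hA s 0 sh h00; rewrite scale0r addr0.
have Axs := hA s 0 sh h00; rewrite scale0r addr0 in Axs.
have [//|t th|t th tE] := @MVT_affine ('D_a f) (x + s *: a) b h.
  by have [daf _] := Cf a; apply: daf; exact: hA.
exists s, t; split=> //.
rewrite -tE -shift_derive.
have <- : 'D_a g (x + s *: a) = 'D_a (fun y => f (y + h *: b)) (x + s *: a) -
    'D_a f (x + s *: a).
  rewrite /g; apply: deriveB; apply: diff_derivable; last exact: df.
  by apply: dfb; exact: hA.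
by rewrite -gE.
Qed.

Lemma derive_comm (A : set X) (f : X -> R) (x a b : X) :
  open A -> Ck 2 A f -> A x -> 'D_a ('D_b f) x = 'D_b ('D_a f) x.
Proof.
move=> oA Cf Ax; have [df Ckf] := Cf.
have cab : {for x, continuous ('D_a ('D_b f))}.
  by have [_ c] := Ckf b; exact: c.
have cba : {for x, continuous ('D_b ('D_a f))}.
  by have [_ c] := Ckf a; exact: c.
apply/eqP; rewrite -subr_eq0 -normr_le0; apply/ler_addgt0Pl => e e0.
rewrite addr0; have e20 : 0 < e / 2 by rewrite divr_gt0.
have near_x : \forall y \near x, [/\ A y,
    `|'D_a ('D_b f) x - 'D_a ('D_b f) y| < e / 2 &
    `|'D_b ('D_a f) x - 'D_b ('D_a f) y| < e / 2].
  have nA := open_near oA Ax (fun y Ay => Ay).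
  move/cvgrPdist_lt : cab => /(_ _ e20) n1.
  move/cvgrPdist_lt : cba => /(_ _ e20) n2.
  apply: filterS3 nA n1 n2 => y Ay d1 d2.
  by split; [exact: Ay|exact: d1|exact: d2].
(* With h = r / m the whole parallelogram spanned by h a and h b stays in the ball of radius r; the
   summand 1 keeps [m] positive when [a] and [b] vanish. *)
have /nbhs_ballP[r /= r0 rP] := near_x; pose m := `|a| + `|b| + 1.
have m0 : 0 < m by rewrite ltr_wpDl // addr_ge0.
pose h := r / m; have h0 : 0 < h by rewrite divr_gt0.
have inball s t : 0 <= s <= h -> 0 <= t <= h ->
    ball x r (x + s *: a + t *: b).
  move=> /andP[s0 sh] /andP[t0 th]; rewrite -ball_normE /ball_ /=.
  rewrite -addrA opprD addrA subrr sub0r normrN.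
  apply: le_lt_trans (ler_normD _ _) _; rewrite !normrZ.
  rewrite ger0_norm // (ger0_norm t0).
  apply: (@le_lt_trans _ _ (h * (`|a| + `|b|))).
    by rewrite mulrDr lerD // ler_wpM2r.
  have -> : r = h * m by rewrite /h divfK // gt_eqF.
  by rewrite ltr_pM2l // ltrDl.
have hA1 s t : 0 <= s <= h -> 0 <= t <= h -> A (x + s *: a + t *: b).
  by move=> sh th; case: (rP _ (inball s t sh th)).
have hA2 s t : 0 <= s <= h -> 0 <= t <= h -> A (x + s *: b + t *: a).
  by move=> sh th; rewrite addrAC; exact: hA1.
(* The same second difference, computed in both orders, equates the two mixed derivatives at
   intermediate points, each within e / 2 of its value at [x]. *)
have [s [t [sh th st]]] := second_difference oA Cf h0 hA1.
have [s' [t' [sh' th' st']]] := second_difference oA Cf h0 hA2.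
have [_ _ c1] := rP _ (inball s t sh th).
have [_ c2 _] := rP _ (inball t' s' th' sh').
rewrite [in x + t' *: a + s' *: b]addrAC in c2.
apply: (approx_eq (gt_eqF h0) _ c2 c1); rewrite -st' -st.
by rewrite (addrAC x); ring.
Qed.

End Schwarz.

(** * Directional derivatives in space-time and composition with the projection *)

Section Spacetime.
Context {R : realType}.
Implicit Types (z e : spacetime R).

Lemma spacetime_sum e :
  e = \sum_(k < 3) e.1 k 0 *: dirx k + e.2 *: dirt.
Proof.
case: e => x t /=; apply: injective_projections => /=.
  rewrite raddf_sum /= scaler0 addr0; apply/matrixP => i j; rewrite summxE ord1.
  rewrite (bigD1 i) //= !mxE !eqxx mulr1 big1 ?addr0 // => k ki.
  by rewrite !mxE eq_sym (negbTE ki) mulr0.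
rewrite raddf_sum /= big1 ?add0r ?mulr1 // => [|k _]; last by rewrite scaler0.
by rewrite /GRing.scale /= mulr1.
Qed.

Lemma derive_spacetime (f : spacetime R -> R) z e : differentiable f z ->
  'D_e f z = \sum_(k < 3) e.1 k 0 * pdx k f z + e.2 * pdt f z.
Proof.
move=> df; rewrite deriveE // {1}[e]spacetime_sum linearD linear_sum.
congr (_ + _); last by rewrite linearZ /pdt deriveE.
by apply: eq_bigr => k _; rewrite linearZ /pdx deriveE.
Qed.

Lemma differentiable_projt (proj : spacetime R -> vec R) z :
  differentiable proj z -> differentiable (fun z => (proj z, z.2)) z.
Proof.
move=> dp; apply: differentiable_pair => //.
by apply: linear_differentiable => y; exact: cvg_snd.
Qed.

Lemma derive_projt (proj : spacetime R -> vec R) z e :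
  differentiable proj z -> 'D_e (fun z => (proj z, z.2)) z = ('D_e proj z, e.2).
Proof.
move=> dp; have ds : differentiable (fun z : spacetime R => z.2) z.
  by apply: linear_differentiable => y; exact: cvg_snd.
rewrite deriveE; last exact: differentiable_pair.
rewrite diff_pair //= -deriveE //; congr pair.
by rewrite diff_lin // => y; exact: cvg_snd.
Qed.

Lemma derive_ext (proj : spacetime R -> vec R) (f : spacetime R -> R) z e :
  differentiable proj z -> differentiable f (proj z, z.2) ->
  'D_e (ext proj f) z =
  \sum_(k < 3) 'D_e (fun z => proj z k 0) z * pdx k f (proj z, z.2) +
  e.2 * pdt f (proj z, z.2).
Proof.
move=> dp df.
rewrite [LHS](derive_chain (F := fun z => (proj z, z.2)) e
  (differentiable_projt dp) df).
rewrite derive_spacetime // derive_projt //=; congr (_ + _).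
by apply: eq_bigr => k _; rewrite derive_entry.
Qed.

(** By the chain rule a derivative of [ext proj f] is a combination of extensions of the partial
    derivatives of [f], with derivatives of [proj] as coefficients; hence an induction over all [f]
    at once. *)
Lemma Ck_ext n (A W : set (spacetime R)) (proj : spacetime R -> vec R)
    (f : spacetime R -> R) :
  open A -> Ck n A proj -> Ck n W f -> (forall z, A z -> W (proj z, z.2)) ->
  Ck n A (ext proj f).
Proof.
move=> oA + + AW; elim: n f => [|n IHn] f.
  move=> cp cf z Az; have cs : {for z, continuous (fun z : spacetime R => z.2)}.
    exact: cvg_snd.
  have cpair : {for z, continuous (fun z => (proj z, z.2))}.
    exact: cvg_pair (cp z Az) cs.
  exact: (@continuous_comp _ _ _ (fun z => (proj z, z.2)) f z cpair
    (cf _ (AW z Az))).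
move=> Cp [df Cf]; have [dp Cdp] := Cp; split=> [z Az|e].
  apply: (@differentiable_comp R _ _ _ (fun z => (proj z, z.2)) f).
    exact/differentiable_projt/dp.
  by apply: df; exact: AW.
have Cp' := CkW Cp.
have CE : Ck n A (fun z => \sum_(k < 3) 'D_e proj z k 0 * ext proj (pdx k f) z +
    e.2 * ext proj (pdt f) z).
  apply: CkD => //; last by apply: CkM (Ck_cst _ _ _) (IHn _ Cp' (Cf _)).
  apply: Ck_sum => // k; apply: CkM (IHn _ Cp' (Cf _)) => //.
  by apply: Ck_entry => //; exact: Cdp.
apply: Ck_eq CE => // z Az; rewrite derive_ext //; last 2 first.
- exact: dp.
- by apply: df; exact: AW.
by congr (_ + _); apply: eq_bigr => k _; rewrite derive_entry //; exact: dp.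
Qed.

End Spacetime.

(** * Limits along segments and functions with small one-sided bounds *)

Section RealLimits.
Context {R : realType}.

Lemma closure_affine (X : normedModType R) (A : set X) (z w : X) (r : R) :
  0 < r -> (forall s, 0 <= s < r -> A (z + s *: w)) -> closure A (z + r *: w).
Proof.
move=> r0 hA B nB.
have nearr : \forall s \near r, B (z + s *: w).
  by have := @affine_continuous _ X z w r => /(_ _ nB).
have [s [Bs s0 sr]] : exists s, [/\ B (z + s *: w), 0 < s & s < r].
  apply: (@filter_ex _ (r^'-)); near=> s; split; near: s.
  - exact: cvg_within nearr.
  - exact: nbhs_left_gt.
  - exact: nbhs_left_lt.
by exists (z + s *: w); split => //; apply: hA; rewrite sr ltW.
Unshelve. all: by end_near. Qed.

Lemma le_affine_limit (X : normedModType R) (f : X -> R) (z w : X) (C r : R) k :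
  0 < r -> {for z + r *: w, continuous f} ->
  (forall s, 0 <= s < r -> `|f (z + s *: w)| <= C * s ^+ k) ->
  `|f (z + r *: w)| <= C * r ^+ k.
Proof.
move=> r0 cf hf; rewrite -subr_ge0.
pose g s := C * s ^+ k - `|f (z + s *: w)|.
have cg : g s @[s --> r] --> g r.
  apply: cvgB.
    by apply: cvgM; [exact: cvg_cst|exact: exprn_continuous].
  apply: cvg_norm.
  exact: (continuous_comp (@affine_continuous _ X z w r) cf).
have cgl : g s @[s --> r^'-] --> g r by apply: cvg_within_filter cg.
rewrite -/(g r) -(cvg_lim _ cgl) //; apply: limr_ge.
  by apply/cvg_ex; exists (g r).
near=> s; rewrite subr_ge0; apply: hf; apply/andP; split.
  by apply: ltW; near: s; exact: nbhs_left_gt.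
by near: s; exact: nbhs_left_lt.
Unshelve. all: by end_near. Qed.

Lemma le_linear_eq0 (a C r : R) :
  0 < r -> (forall s, 0 < s < r -> `|a| <= C * s) -> a = 0.
Proof.
move=> r0 ha; have C0 : 0 <= C.
  have := ha (r / 2); rewrite divr_gt0 // gtr_pMr // invf_lt1 // ltr1n => /(_ isT).
  move=> /(le_trans (normr_ge0 _)); rewrite pmulr_lge0 // divr_gt0 //.
apply/eqP; rewrite -normr_le0; apply/ler_addgt0Pl => e e0; rewrite addr0.
(* r / 2 keeps [s] in the admissible range, and e / (C + 1) makes C s at most e, also when C = 0. *)
pose s := Num.min (r / 2) (e / (C + 1)).
have C1 : 0 < C + 1 by rewrite ltr_wpDl.
have s0 : 0 < s by rewrite lt_min !divr_gt0.
have sr : s < r.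
  by rewrite gt_min gtr_pMr // invf_lt1 // ltr1n.
apply: le_trans (ha s _) _; first by rewrite s0.
have : s <= e / (C + 1) by rewrite ge_min lexx orbT.
rewrite ler_pdivlMr // => /(le_trans _); apply.
by rewrite mulrC ler_pM2l // lerDl.
Qed.

(** Bounds on one side suffice: since [f] is differentiable at 0, its value and its derivative there
    are limits from the right, and f(s) / s is at most C s in absolute value. *)
Lemma quadratic_bound_eq0 (f : R -> R) (C r : R) :
  0 < r -> differentiable f 0 -> (forall s, 0 < s < r -> `|f s| <= C * s ^+ 2) ->
  f 0 = 0 /\ 'D_1 f 0 = 0.
Proof.
move=> r0 df hf.
have f0 : f 0 = 0.
  have cf : f s @[s --> 0^'+] --> f 0.
    by apply: cvg_within_filter; exact: differentiable_continuous.
  have c0 : f s @[s --> 0^'+] --> 0.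
    apply/norm_cvg0P.
    apply: (@squeeze_cvgr _ _ _ _ (fun=> 0) (fun s => C * s ^+ 2)).
    - near=> s; rewrite normr_ge0 /=; apply: hf; apply/andP; split.
        by near: s; exact: nbhs_right_gt.
      by near: s; exact: nbhs_right_lt.
    - exact: cvg_cst.
    - suff : C * s ^+ 2 @[s --> 0^'+] --> C * 0 ^+ 2 by rewrite expr0n mulr0.
      apply: cvg_within_filter.
      by apply: cvgM; [exact: cvg_cst|exact: exprn_continuous].
  by rewrite -(cvg_lim _ cf) // (cvg_lim _ c0).
split=> //.
have dd : (fun h => h^-1 *: (f (h *: 1 + 0) - f 0)) @ 0^' --> 'D_1 f 0.
  exact: (@diff_derivable _ _ _ f 0 1 df).
have dr : (fun h => h^-1 * f h) @ 0^'+ --> 'D_1 f 0.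
  have -> : (fun h => h^-1 * f h) = (fun h => h^-1 *: (f (h *: 1 + 0) - f 0)).
    by apply/funext => h; rewrite f0 subr0 addr0 /GRing.scale /= mulr1.
  exact: cvg_dnbhs_at_right dd.
have d0 : (fun h => h^-1 * f h) @ 0^'+ --> 0.
  apply/norm_cvg0P; apply: (@squeeze_cvgr _ _ _ _ (fun=> 0) (fun s => C * s)).
  - near=> s; rewrite normr_ge0 /=.
    have s0 : 0 < s by near: s; exact: nbhs_right_gt.
    rewrite normrM normfV (gtr0_norm s0) mulrC ler_pdivrMr // -mulrA -expr2.
    by apply: hf; rewrite s0 /=; near: s; exact: nbhs_right_lt.
  - exact: cvg_cst.
  - suff : C * s @[s --> 0^'+] --> C * 0 by rewrite mulr0.
    by apply: cvg_within_filter; apply: cvgM; [exact: cvg_cst|exact: cvg_id].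
by rewrite -(cvg_lim _ dr) // (cvg_lim _ d0).
Unshelve. all: by end_near. Qed.

End RealLimits.

(** * Euclidean norm and distance to a set *)

Section Euclidean.
Context {R : realType}.
Implicit Types (a b : vec R) (G : set (vec R)).

Lemma dotE a b : dot a b = a 0 0 * b 0 0 + a 1 0 * b 1 0 + a 2 0 * b 2 0.
Proof.
rewrite /dot !big_ord_recl big_ord0 addr0 addrA.
by congr (_ + _ * _ + _ * _); congr (_ _ 0); exact: val_inj.
Qed.

Lemma enormZ (s : R) a : enorm (s *: a) = `|s| * enorm a.
Proof.
rewrite /enorm.
have -> : dot (s *: a) (s *: a) = s ^+ 2 * dot a a.
  by rewrite /dot mulr_sumr; apply: eq_bigr => i _; rewrite !mxE; ring.
by rewrite sqrtrM ?sqr_ge0 // sqrtr_sqr.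
Qed.

Lemma enorm1_dot a : enorm a = 1 -> dot a a = 1.
Proof.
move=> a1; have : enorm a ^+ 2 = 1 by rewrite a1 expr1n.
by rewrite /enorm sqr_sqrtr // /dot sumr_ge0 // => i _; rewrite -expr2 sqr_ge0.
Qed.

Lemma dist_le (x y : vec R) G : G y -> dist x G <= enorm (x - y).
Proof.
move=> Gy; apply: ge_inf; last by exists y.
by exists 0 => _ [y' _ <-]; exact: sqrtr_ge0.
Qed.

Lemma dist_lt (x : vec R) (r : R) G : G !=set0 -> dist x G < r ->
  exists2 y, G y & enorm (x - y) < r.
Proof.
move=> [y0 Gy0] /inf_lt []; first by exists (enorm (x - y0)), y0.
by move=> _ [y Gy <-] er; exists y.
Qed.

Lemma enorm_continuous : continuous (@enorm R).
Proof.
move=> a; apply: (continuous_comp (f := fun a => dot a a)); last first.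
  exact: sqrt_continuous.
suff : {for a, continuous (fun a : vec R =>
    a 0 0 * a 0 0 + a 1 0 * a 1 0 + a 2 0 * a 2 0)}.
  by rewrite -(funext (fun a : vec R => dotE a a)).
pose sq i (a : vec R) := a i 0 * a i 0.
have csq i : {for a, continuous (sq i)}.
  by apply: continuousM; exact: coord_continuous.
exact: continuousD (continuousD (csq 0) (csq 1)) (csq 2).
Qed.

End Euclidean.

(** * Rays, projection and signed distance near the moving surface *)

Section MovingSurface.
Context {R : realType} (T delta : R) (Gam : R -> set (vec R)).
Context (nu : spacetime R -> vec R) (VN : spacetime R -> R).
Context (proj : spacetime R -> vec R) (d : spacetime R -> R).

Local Notation N r := (tube `]0, T[ (tubular_nbhd r Gam)).
Local Notation ST := (tube `]0, T[ Gam).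

(** The normal is frozen at the foot point [z], so the ray is affine in space-time and
    differentiation along it is a directional derivative in the fixed direction [(nu z, 0)]. *)
Definition ray (z : spacetime R) (s : R) : spacetime R := z + s *: (nu z, 0).

Lemma rayE z s : ray z s = (z.1 + s *: nu z, z.2).
Proof.
by rewrite /ray; case: z => x t; congr pair => /=; rewrite scaler0 addr0.
Qed.

Lemma ray0 z : ray z 0 = z.
Proof. by rewrite /ray scale0r addr0. Qed.

Lemma tube_time r z : N r z -> 0 <= z.2 <= T.
Proof. by case; rewrite /= in_itv /= => /andP[/ltW -> /ltW ->]. Qed.

Lemma ST_time z : ST z -> 0 <= z.2 <= T.
Proof. by case; rewrite /= in_itv /= => /andP[/ltW -> /ltW ->]. Qed.

Context (mG : moving_surface T Gam) (uN : outward_unit_normal T Gam nu).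
Context (nV : normal_velocity T Gam nu VN).
Context (tc : tubular_coordinates T delta Gam nu proj d) (delta0 : 0 < delta).

(** A point of the surface closer than [r] to [z.1] is followed along its material trajectory. The
    trajectory is continuous in time and stays on the surface, so nearby space-time points are also
    closer than [r] to it. *)
Lemma open_tube r : open (N r).
Proof.
rewrite openE => z [zT zr]; have zT' := tube_time (conj zT zr).
have [cs [Phi [Psi [sPhi _ _ PhiG PhiPsi]]]] := mG.
have [ne _ _ _] := cs _ zT'.
have [y Gy yr] := dist_lt ne zr.
have [G0 PhiE] := PhiPsi _ _ zT' Gy; set X := Psi _ in G0 PhiE.
(* Continuity is available for the smooth extension [g], not for [Phi] itself, which is controlled
   only on the tube over [0, T]. *)
have [g [[W [oW AW gW]] Phig]] := sPhi.
have inT (t : R) : t \in `]0, T[ -> tube `[0, T] (fun=> Gam 0) (X, t).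
  by rewrite in_itv => /andP[/ltW t0 /ltW tT]; split=> //=; rewrite in_itv /= t0.
have cg : {for (X, z.2), continuous g} by apply: (gW 0%N); exact/AW/inT.
have cXt : {for z, continuous (fun w : spacetime R => (X, w.2))}.
  exact: cvg_pair (cvg_cst _) cvg_snd.
have ce : {for z, continuous (fun w : spacetime R => enorm (w.1 - g (X, w.2)))}.
  have cd : {for z, continuous (fun w : spacetime R => w.1 - g (X, w.2))}.
    apply: cvgB; first exact: cvg_fst.
    exact: (@continuous_comp _ _ _ (fun w : spacetime R => (X, w.2)) g z cXt cg).
  exact: (@continuous_comp _ _ _ _ (@enorm R) z cd (@enorm_continuous R _)).
have gE t : t \in `]0, T[ -> g (X, t) = Phi (X, t).
  by move=> /inT /Phig.
have near1 : \forall w \near z, enorm (w.1 - g (X, w.2)) < r.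
  by apply: cvgr_lt ce _ _; rewrite gE // PhiE.
have near2 : \forall w \near z, w.2 \in `]0, T[.
  have : z.2 \in `]0, T[ by [].
  rewrite in_itv => /andP[z0 zT1].
  have cs2 : {for z, continuous (fun w : spacetime R => w.2)} by exact: cvg_snd.
  have n1 : \forall w \near z, 0 < w.2 by apply: cvgr_gt cs2 _ z0.
  have n2 : \forall w \near z, w.2 < T by apply: cvgr_lt cs2 _ zT1.
  apply: filterS2 n1 n2 => w w0 wT.
  by rewrite in_itv /= w0.
apply: filterS2 near1 near2 => w wr wT; split => //.
apply: le_lt_trans wr; rewrite gE //; apply: dist_le.
have := inT _ wT => -[/=]; rewrite in_itv /= => wT' _.
by have [] := PhiG _ _ wT' G0.
Qed.


Lemma ST_unit z : ST z -> dot (nu z) (nu z) = 1.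
Proof.
by move=> zS; apply: enorm1_dot; case: z zS => x t [zT Gx];
  exact: (normal_unit uN (ST_time (conj zT Gx))).
Qed.

(** The foot point is at distance |s|, so the ray point lies in the tube; uniqueness of the normal
    decomposition then identifies its coordinates. *)
Lemma ray_coordinates z s : ST z -> `|s| < delta ->
  [/\ proj (ray z s) = z.1, d (ray z s) = s & dist (ray z s).1 (Gam z.2) = `|s|].
Proof.
case: z => y t [tT Gy] sd; have t0T := ST_time (conj tT Gy : ST (y, t)).
have n1 : enorm (nu (y, t)) = 1 by exact: (normal_unit uN t0T Gy).
have sE : enorm (s *: nu (y, t)) = `|s| by rewrite enormZ n1 mulr1.
rewrite !rayE /=; set x := y + _.
have xn : tubular_nbhd delta Gam t x.
  apply: le_lt_trans (dist_le x Gy) _.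
  by rewrite /x addrC addKr sE.
have [<- sdE] := proj_unique tc t0T xn Gy sd erefl.
split=> //; rewrite -(proj_closest tc t0T xn).
have [<- _] := proj_unique tc t0T xn Gy sd erefl.
by rewrite /x addrC addKr.
Qed.

Lemma ray_tube z s r : ST z -> `|s| < r -> r <= delta -> N r (ray z s).
Proof.
move=> zS sr rd; have [_ _ ds] := ray_coordinates zS (lt_le_trans sr rd).
move: ds; rewrite rayE; case: zS => ? _ ds; split => //=.
by rewrite /tubular_nbhd /= ds.
Qed.

Lemma ST_tube z r : ST z -> 0 < r -> r <= delta -> N r z.
Proof. by move=> zS r0 rd; rewrite -(ray0 z); apply: ray_tube; rewrite ?normr0. Qed.

Lemma ST_proj z : ST z -> proj z = z.1.
Proof.
move=> zS; have [|+ _ _] := @ray_coordinates z 0 zS; first by rewrite normr0.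
by rewrite ray0.
Qed.

Lemma ST_d z : ST z -> d z = 0.
Proof.
move=> zS; have [|_ + _] := @ray_coordinates z 0 zS; first by rewrite normr0.
by rewrite ray0.
Qed.

Lemma ext_ray (Y : Type) (f : spacetime R -> Y) z s : ST z -> `|s| < delta ->
  ext proj f (ray z s) = f z.
Proof.
move=> zS sd; have [+ _ _] := ray_coordinates zS sd.
by rewrite /ext rayE => -> /=; case: (z).
Qed.

Lemma proj_ST z : N delta z -> ST (proj z, z.2).
Proof.
move=> zN; split; first by case: zN.
by case: z zN => x t zN; apply: (proj_on tc); [exact: tube_time zN|case: zN].
Qed.

Lemma ext_eq (Y : Type) (f g : spacetime R -> Y) z : N delta z ->
  (forall z, ST z -> f z = g z) -> ext proj f z = ext proj g z.
Proof. by move=> zN fg; apply: fg; exact: proj_ST. Qed.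

Lemma ray_boundary z r : ST z -> 0 < r < delta ->
  boundary (tubular_nbhd r Gam z.2) (ray z r).1.
Proof.
move=> zS /andP[r0 rd]; split.
  rewrite rayE; apply: (@closure_affine R _ _ z.1 (nu z)) => // s /andP[s0 sr].
  have sr' : `|s| < r by rewrite ger0_norm.
  have [_] := ray_tube zS sr' (ltW rd).
  by rewrite rayE.
move=> /interior_subset; rewrite /tubular_nbhd /=.
by have [|_ _ ->] := @ray_coordinates z r zS; rewrite gtr0_norm // ltxx.
Qed.

Lemma ray_closure z r : ST z -> 0 < r -> r <= delta -> closure (N r) (ray z r).
Proof.
move=> zS r0 rd; apply: closure_affine => // s /andP[s0 sr].
by apply: ray_tube; rewrite ?ger0_norm.
Qed.

Lemma smooth_on_Cinf (Y : normedModType R) (A B : set (spacetime R))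
    (f : spacetime R -> Y) :
  open B -> B `<=` A -> smooth_on A f -> Cinf B f.
Proof.
move=> oB BA [g [[W [oW AW gW]] fg]] n.
apply: (@Ck_eq _ _ _ _ _ g) => //; first by move=> x Bx; rewrite fg //; exact: BA.
by apply: Ck_subset (gW n) => x /BA/AW.
Qed.

Lemma Cinf_proj : Cinf (N delta) proj.
Proof.
by apply: smooth_on_Cinf (proj_smooth tc); [exact: open_tube|exact: subset_closure].
Qed.

Lemma Cinf_d : Cinf (N delta) d.
Proof.
by apply: smooth_on_Cinf (d_smooth tc); [exact: open_tube|exact: subset_closure].
Qed.

(** [ext proj f] evaluates [f] only on the surface, so [f] may be replaced by its smooth extension
    before the chain rule is applied. *)
Lemma Cinf_ext (f : spacetime R -> R) :
  smooth_on (closure ST) f -> Cinf (N delta) (ext proj f).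
Proof.
move=> [g [[W [oW AW gW]] fg]] n.
have fgS z : ST z -> g z = f z by move=> zS; rewrite fg //; exact: subset_closure.
apply: (@Ck_eq _ _ _ _ _ (ext proj g)) => //; first exact: open_tube.
  by move=> z zN; exact: ext_eq.
apply: Ck_ext (Cinf_proj n) (gW n) _; first exact: open_tube.
by move=> z zN; apply/AW/subset_closure/proj_ST.
Qed.

Lemma smooth_on_entry (A : set (spacetime R)) m k
    (F : spacetime R -> 'M[R]_(m, k)) i j :
  smooth_on A F -> smooth_on A (fun z => F z i j).
Proof.
move=> [g [[W [oW AW gW]] fg]]; exists (fun z => g z i j); split.
  by exists W; split => // n; exact: Ck_entry.
by move=> z Az; rewrite fg.
Qed.

Lemma differentiable_ray (Y : normedModType R) (f : spacetime R -> Y) z s :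
  differentiable f (ray z s) -> differentiable (fun s => f (ray z s)) s.
Proof.
move=> df.
by apply: (@differentiable_comp R R _ _ (fun s : R => z + s *: (nu z, 0)) f).
Qed.

Lemma derive_ray (Y : normedModType R) (f : spacetime R -> Y) z s :
  'D_1 (fun s => f (ray z s)) s = 'D_(nu z, 0) f (ray z s).
Proof. by rewrite derive_affine scale1r. Qed.

Lemma smooth_near_affine (Y : normedModType R) (A : set (spacetime R))
    (f : spacetime R -> Y) z w s :
  open A -> Cinf A f -> A (z + s *: w) ->
  smooth_near [set s] (fun s : R => f (z + s *: w)).
Proof.
move=> oA Cf As; exists ((fun s : R => z + s *: w) @^-1` A); split.
- exact: open_affine.
- by move=> _ ->.
- by move=> n; exact: Ck_affine.
Qed.

(** Projecting a coordinate line at fixed time gives a curve in the surface, whose velocity is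
    tangent. *)
Lemma pdx_proj_tangent z i : ST z -> dot (pdx i proj z) (nu z) = 0.
Proof.
move=> zS; have zN : N delta z by exact: ST_tube.
have zE : z = (z.1, z.2) by case: (z).
rewrite {2}zE; apply: (normal_orth uN (ST_time zS)); first by case: zS.
exists (fun s => proj (z + s *: dirx i)); split.
- apply: smooth_near_affine Cinf_proj _; first exact: open_tube.
  by rewrite scale0r addr0.
- have : \forall s \near 0, N delta (z + s *: dirx i).
    apply: affine_continuous; rewrite scale0r addr0.
    exact: open_nbhs_nbhs (conj (open_tube (r := delta)) zN).
  apply: filterS => s /proj_ST [_] /=.
  by rewrite scaler0 addr0.
- by rewrite scale0r addr0 ST_proj.
- by rewrite derive_affine scale1r scale0r addr0.
Qed.

(** The projection of a fixed point, as time varies, is a curve carried by the moving surface. *)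
Lemma pdt_proj_velocity z : ST z -> dot (pdt proj z) (nu z) = VN z.
Proof.
move=> zS; have zN : N delta z by exact: ST_tube.
have zE : (z.1, 0) + z.2 *: dirt = z.
  case: (z) => x t; congr pair => /=; first by rewrite scaler0 addr0.
  by rewrite add0r /GRing.scale /= mulr1.
pose c (s : R) := proj ((z.1, 0) + s *: dirt).
have ct : (c z.2, z.2) = z by rewrite /c zE ST_proj //; case: (z).
rewrite -{3}ct (nV (t := z.2) (c := c)).
- by rewrite ct derive_affine scale1r zE.
- by case: zS; rewrite /= in_itv.
- by apply: smooth_near_affine Cinf_proj _; [exact: open_tube|rewrite zE].
have : \forall s \near z.2, N delta ((z.1, 0) + s *: dirt).
  apply: affine_continuous; rewrite zE.
  exact: open_nbhs_nbhs (conj (open_tube (r := delta)) zN).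
apply: filterS => s /proj_ST [_] /=.
by rewrite add0r /GRing.scale /= mulr1.
Qed.

(** Differentiate x = proj + d nu(proj, t). On the surface d = 0, so the term with the derivative of
    the normal drops out. *)
Lemma derive_proj z e k : ST z ->
  'D_e (fun z => proj z k 0) z = e.1 k 0 - 'D_e d z * nu z k 0.
Proof.
move=> zS; have zN : N delta z by exact: ST_tube.
have [dp _] := Cinf_proj 1; have [dd _] := Cinf_d 1.
have [dn _] := Cinf_ext (smooth_on_entry k 0 (normal_smooth uN)) 1.
have nearz : \forall z' \near z, proj z' k 0 + d z' * nu (proj z', z'.2) k 0 =
    z'.1 k 0.
  apply: open_near zN _; first exact: open_tube.
  move=> [x t] xN; rewrite [in RHS](proj_decomp tc (tube_time xN) (proj2 xN)).
  by rewrite !mxE.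
have := near_eq_derive e nearz.
rewrite deriveD; last 2 first.
- exact/diff_derivable/differentiable_entry/dp.
- by apply/diff_derivable/differentiableM; [exact: dd|exact: dn].
rewrite deriveM; last 2 first.
- exact/diff_derivable/dd.
- exact/diff_derivable/dn.
rewrite (ST_d zS) scale0r add0r (_ : nu (proj z, z.2) k 0 = nu z k 0); last first.
  by rewrite ST_proj //; case: (z).
have -> : 'D_e (fun z : spacetime R => z.1 k 0) z = e.1 k 0.
  have dl : differentiable (fun z : spacetime R => z.1) z.
    by apply: linear_differentiable => y; exact: cvg_fst.
  rewrite -derive_entry // deriveE // diff_lin //= => y; exact: cvg_fst.
by move=> <-; rewrite /GRing.scale /= mulrC addrK.
Qed.

Lemma derive_d z e : ST z ->
  'D_e d z = dot e.1 (nu z) - dot ('D_e proj z) (nu z).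
Proof.
move=> zS; have zN : N delta z by exact: ST_tube.
have [dp _] := Cinf_proj 1.
have -> : dot ('D_e proj z) (nu z) =
    \sum_(k < 3) (e.1 k 0 - 'D_e d z * nu z k 0) * nu z k 0.
  by apply: eq_bigr => k _; rewrite (derive_entry _ _ _ (dp z zN)) derive_proj.
rewrite (eq_bigr (fun k => e.1 k 0 * nu z k 0 -
  'D_e d z * (nu z k 0 * nu z k 0))); last by move=> k _; ring.
by rewrite sumrB -mulr_sumr -/(dot (nu z) (nu z)) ST_unit // /dot; ring.
Qed.

Lemma pdx_d z i : ST z -> pdx i d z = nu z i 0.
Proof.
move=> zS; rewrite /pdx derive_d // pdx_proj_tangent // subr0 /dot (bigD1 i) //=.
rewrite big1 ?addr0 ?mxE ?eqxx ?mul1r // => k ki.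
by rewrite !mxE (negbTE ki) mul0r.
Qed.

Lemma pdt_d z : ST z -> pdt d z = - VN z.
Proof.
move=> zS; rewrite /pdt derive_d // pdt_proj_velocity // /dot big1 ?sub0r // => k _.
by rewrite !mxE mul0r.
Qed.

Lemma derive_normal (f : spacetime R -> R) z w : differentiable f w ->
  'D_(nu z, 0) f w = \sum_(k < 3) nu z k 0 * pdx k f w.
Proof. by move=> df; rewrite derive_spacetime //= mul0r addr0. Qed.

(** The spatial derivative of the projection on the surface is the tangential projector, because the
    gradient of [d] there is [nu]. *)
Lemma pdx_ext (f : spacetime R -> R) z i : ST z -> differentiable f z ->
  pdx i (ext proj f) z = pdx i f z - nu z i 0 * 'D_(nu z, 0) f z.
Proof.
move=> zS df; have zN : N delta z by exact: ST_tube.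
have [dp _] := Cinf_proj 1.
have pz : (proj z, z.2) = z by rewrite ST_proj //; case: (z).
rewrite /pdx derive_ext; [|exact: dp|by rewrite pz].
rewrite pz mul0r addr0 derive_normal //.
under eq_bigr => k _ do rewrite derive_proj // -/(pdx i d z) pdx_d // mulrBl.
rewrite sumrB; congr (_ - _); last first.
  by rewrite mulr_sumr; apply: eq_bigr => k _; rewrite mulrA.
rewrite (bigD1 i) //= big1 ?addr0 ?mxE ?eqxx ?mul1r // => k ki.
by rewrite !mxE (negbTE ki) mul0r.
Qed.

(** The time derivative of [d] on the surface is - [VN], so the projection moves with velocity [VN]
    [nu] and picks up a normal derivative of [f]. *)
Lemma pdt_ext (f : spacetime R -> R) z : ST z -> differentiable f z ->
  pdt (ext proj f) z = pdt f z + VN z * 'D_(nu z, 0) f z.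
Proof.
move=> zS df; have zN : N delta z by exact: ST_tube.
have [dp _] := Cinf_proj 1.
have pz : (proj z, z.2) = z by rewrite ST_proj //; case: (z).
rewrite /pdt derive_ext; [|exact: dp|by rewrite pz].
rewrite pz mul1r addrC derive_normal // mulr_sumr; congr (_ + _).
apply: eq_bigr => k _; rewrite derive_proj // -/(pdt d z) pdt_d //.
by rewrite !mxE; ring.
Qed.

(** The gradient of the extension has no normal component on the surface, so applying [PGam] leaves
    it unchanged. *)
Lemma pdtan_ST (f : spacetime R -> R) z i : ST z -> differentiable f z ->
  pdtan nu proj i f z = pdx i f z - nu z i 0 * 'D_(nu z, 0) f z.
Proof.
move=> zS df; rewrite /pdtan /tgrad /PGam mulmxBl mul1mx -mulmxA !mxE big_ord1.
rewrite pdx_ext // !mxE.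
have -> : \sum_j (nu z)^T 0 j * grad (ext proj f) z j 0 = 0; last first.
  by rewrite mulr0 subr0.
under eq_bigr => k _ do rewrite !mxE pdx_ext // mulrBr.
rewrite sumrB -derive_normal //.
rewrite (eq_bigr (fun k => nu z k 0 * nu z k 0 * 'D_(nu z, 0) f z)); last first.
  by move=> k _; ring.
by rewrite -mulr_suml -/(dot (nu z) (nu z)) ST_unit // mul1r subrr.
Qed.

End MovingSurface.

(** * Column-valued functions and iterated partial derivatives *)

Section ColumnsAndIteratedDerivatives.
Context {R : realType}.

Lemma CkZl (X Y : normedModType R) n (A : set X) (f : X -> R) (c : Y) :
  open A -> Ck n A f -> Ck n A (fun x => f x *: c).
Proof.
move=> oA; elim: n f => [|n IHn] f.
  by move=> cf x Ax; apply: cvgZr_tmp; exact: cf.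
move=> [df Cf]; split=> [x Ax|e]; first exact/differentiableZl/df.
apply: Ck_eq (IHn _ (Cf e)) => // x Ax; rewrite !deriveE; last 2 first.
- exact/differentiableZl/df.
- exact: df.
by rewrite (diffZl _ (df x Ax)).
Qed.

Lemma Ck_col (X : normedModType R) n (A : set X) m (F : X -> 'cV[R]_m) :
  open A -> (forall i, Ck n A (fun x => F x i 0)) -> Ck n A F.
Proof.
move=> oA CF.
have : Ck n A (fun x => \sum_(i < m) F x i 0 *: (delta_mx i 0 : 'cV[R]_m)).
  by apply: Ck_sum => // i; exact: CkZl.
apply: Ck_eq => // x Ax; rewrite [RHS]matrix_sum_delta.
by apply: eq_bigr => i _; rewrite big_ord1.
Qed.

Lemma Cinf_iter_pd (Y : normedModType R) (A : set (spacetime R))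
    (f : spacetime R -> Y) l :
  Cinf A f -> Cinf A (iter_pd l f).
Proof.
move=> Cf; elim: l => [//|o l IHl] n.
by have [_ C] := IHl n.+1; case: o => [i|]; exact: C.
Qed.

Lemma iter_pd_entry (A : set (spacetime R)) m k
    (F : spacetime R -> 'M[R]_(m, k)) l i j z :
  open A -> Cinf A F -> A z ->
  iter_pd l F z i j = iter_pd l (fun z => F z i j) z.
Proof.
move=> oA CF; elim: l z => [//|o l IHl] z Az /=.
have [dF _] := Cinf_iter_pd l CF 1.
have dE e : 'D_e (iter_pd l F) z i j = 'D_e (iter_pd l (fun z => F z i j)) z.
  rewrite (derive_entry _ _ _ (dF z Az)); apply: near_eq_derive.
  exact: open_near oA Az IHl.
by case: o => [ax|]; exact: dE.
Qed.

Lemma iter_pdB (A : set (spacetime R)) (f g : spacetime R -> R) l z :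
  open A -> Cinf A f -> Cinf A g -> A z ->
  iter_pd l (fun z => f z - g z) z = iter_pd l f z - iter_pd l g z.
Proof.
move=> oA Cf Cg; elim: l z => [//|o l IHl] z Az /=.
have [df _] := Cinf_iter_pd l Cf 1; have [dg _] := Cinf_iter_pd l Cg 1.
have dE e : 'D_e (iter_pd l (fun z => f z - g z)) z =
    'D_e (iter_pd l f) z - 'D_e (iter_pd l g) z.
  rewrite (near_eq_derive (g := fun z => iter_pd l f z - iter_pd l g z)).
    by apply: deriveB; apply: diff_derivable; [exact: df|exact: dg].
  exact: open_near oA Az IHl.
by case: o => [ax|]; exact: dE.
Qed.

Lemma norm_entry m k (M : 'M[R]_(m, k)) i j : `|M i j| <= `|M|.
Proof.
rewrite [leRHS]/Num.Def.normr /= mx_normrE.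
exact: (le_bigmax _ (fun ij => `|M ij.1 ij.2|) (i, j)).
Qed.

End ColumnsAndIteratedDerivatives.

(** * Remainder estimates along rays and on the surface *)

Section Remainders.
Context {R : realType} (T delta : R) (Gam : R -> set (vec R)).
Context (nu : spacetime R -> vec R).
Context (proj : spacetime R -> vec R) (d : spacetime R -> R) (eps0 : R).

Local Notation N r := (tube `]0, T[ (tubular_nbhd r Gam)).
Local Notation ST := (tube `]0, T[ Gam).

Context (mG : moving_surface T Gam) (uN : outward_unit_normal T Gam nu).
Context (tc : tubular_coordinates T delta Gam nu proj d).
Context (eps0d : 0 < eps0 < delta).

Lemma tube_subset r : r <= delta -> N r `<=` N delta.
Proof. by move=> rd z [zT zr]; split => //; exact: lt_le_trans zr rd. Qed.

Lemma remainder_entry m k n (r : R -> spacetime R -> 'M[R]_(m, k)) i j :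
  (forall eps, 0 < eps < eps0 -> Cinf (N eps) (r eps)) ->
  remainder T eps0 Gam d n r ->
  remainder T eps0 Gam d n (fun eps z => r eps z i j).
Proof.
move=> Cr [C rC]; exists C => eps z l epsP zN ln.
rewrite -(iter_pd_entry l i j (open_tube mG (r := eps)) (Cr _ epsP) zN).
exact: le_trans (norm_entry _ _ _) (rC _ _ _ epsP zN ln).
Qed.

(* The case s = eps, where the boundary conditions are read, is not part of
   [remainder]: it follows by continuity of the derivatives. *)
Lemma remainder_ray n (f : R -> spacetime R -> R) (F : spacetime R -> R) :
  Cinf (N delta) F ->
  (forall eps, 0 < eps < eps0 -> smooth_near (closure (N eps)) (f eps)) ->
  remainder T eps0 Gam d n (fun eps z => f eps z - F z) ->
  exists2 C, 0 <= C & forall eps z s l,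
    0 < eps < eps0 -> ST z -> 0 <= s <= eps -> (size l <= n)%N ->
    `|iter_pd l (f eps) (ray nu z s) - iter_pd l F (ray nu z s)| <=
    C * s ^+ (n - size l).
Proof.
(* The constant given by [remainder] may be negative, hence its absolute value. *)
move=> CF sf [C rC]; exists `|C| => // eps z s l epsP zS sP ln.
have [e00 e0d] := andP eps0d; have [ep0 ep1] := andP epsP.
have epd : eps < delta by exact: lt_trans ep1 e0d.
have [W [oW cW Wf]] := sf _ epsP.
(* Both functions are smooth on this open set. It contains the ray up to and including s = [eps],
   since [W] covers the closed tube. *)
pose B := W `&` N delta.
have oB : open B by apply: openI => //; exact: open_tube.
have Cf : Cinf B (f eps) by move=> m; apply: Ck_subset (Wf m) => ? [].
have CF' : Cinf B F by move=> m; apply: Ck_subset (CF m) => ? [].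
have rayB s' : 0 <= s' <= eps -> B (ray nu z s').
  move=> /andP[s0 s1]; split; last first.
    by apply: (ray_tube uN tc zS) => //; rewrite ger0_norm // (le_lt_trans s1).
  apply: cW; move: s1; rewrite le_eqVlt => /predU1P[->|s1].
    exact: (ray_closure uN tc zS ep0 (ltW epd)).
  apply: subset_closure; apply: (ray_tube uN tc zS); last exact: ltW.
  by rewrite ger0_norm.
have inner s' : 0 <= s' < eps ->
    `|iter_pd l (fun z => f eps z - F z) (ray nu z s')| <=
    `|C| * s' ^+ (n - size l).
  move=> /andP[s0 s1]; have s1' : `|s'| < eps by rewrite ger0_norm.
  have := rC eps (ray nu z s') l epsP (ray_tube uN tc zS s1' (ltW epd)) ln.
  have [_ -> _] := ray_coordinates uN tc zS (lt_trans s1' epd).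
  rewrite (ger0_norm s0) => /le_trans; apply.
  by rewrite ler_wpM2r ?exprn_ge0 // ler_norm.
rewrite -(iter_pdB l oB Cf CF' (rayB s sP)).
have [s0 s1] := andP sP; move: s1; rewrite le_eqVlt => /predU1P[sE|s1]; last first.
  by apply: inner; rewrite s0.
rewrite sE; apply: le_affine_limit inner => //.
have CB : Cinf B (fun z => f eps z - F z) by move=> m; apply: CkB.
apply: (Cinf_iter_pd l CB 0%N).
by apply: rayB; rewrite lexx ltW.
Qed.

(** At s = 0 the bound is C 0^(n - size l), which vanishes exactly because the inequality
    [size l < n] is strict. Three coefficients thus reach the second derivatives of [u], and two the
    gradient of [p]. *)
Lemma remainder_ST n (f : R -> spacetime R -> R) (F : spacetime R -> R) eps l z :
  Cinf (N delta) F ->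
  (forall eps, 0 < eps < eps0 -> smooth_near (closure (N eps)) (f eps)) ->
  remainder T eps0 Gam d n (fun eps z => f eps z - F z) ->
  0 < eps < eps0 -> ST z -> (size l < n)%N ->
  iter_pd l (f eps) z = iter_pd l F z.
Proof.
move=> CF sf rem epsP zS ln; have [C C0 hC] := remainder_ray CF sf rem.
have := hC eps z 0 l epsP zS; rewrite lexx ray0 => /(_ _ (ltnW ln)).
rewrite expr0n subn_eq0 leqNgt ln mulr0 normr_le0 subr_eq0.
by move=> h; apply/eqP/h; case/andP: epsP => /ltW ->.
Qed.

End Remainders.

(** * Quadratic polynomials of cubic size *)

Section RealBounds.
Context {R : realType}.

(** The coefficients vanish in order of degree: once the lower ones are gone, division by the right
    power of s leaves the next one bounded by a constant times s, surplus powers being absorbed by s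
    < r. *)
Lemma cubic_bound_eq0 (a b c C r : R) : 0 < r ->
  (forall s, 0 < s < r -> `|a + s * b + s ^+ 2 * c| <= C * s ^+ 3) ->
  [/\ a = 0, b = 0 & c = 0].
Proof.
move=> r0 h.
have tri (x y : R) : `|x| <= `|x + y| + `|y|.
  by rewrite -{1}(addrK y x); exact: ler_normB.
have C0 : 0 <= C.
  have r2 : 0 < r / 2 < r by rewrite divr_gt0 // gtr_pMr // invf_lt1 // ltr1n.
  have := le_trans (normr_ge0 _) (h _ r2).
  by rewrite pmulr_lge0 // exprn_gt0 // divr_gt0.
have sX s n : 0 < s < r -> s ^+ n <= r ^+ n.
  by move=> /andP[/ltW s0 /ltW sr]; rewrite lerXn2r // nnegrE // ltW.
have a0 : a = 0.
  apply: (@le_linear_eq0 _ _ (C * r ^+ 2 + (`|b| + r * `|c|)) r) => // s sr.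
  have s0 : 0 <= s by case/andP: sr => /ltW.
  apply: le_trans (tri a (s * b + s ^+ 2 * c)) _; rewrite addrA [leRHS]mulrDl.
  apply: lerD.
    apply: le_trans (h s sr) _; rewrite exprSr mulrA ler_wpM2r // ler_wpM2l //.
    exact: sX.
  have -> : s * b + s ^+ 2 * c = (b + s * c) * s by ring.
  rewrite normrM (ger0_norm s0) ler_wpM2r //.
  apply: le_trans (ler_normD _ _) _; rewrite lerD2l normrM (ger0_norm s0).
  by rewrite ler_wpM2r // ltW //; case/andP: sr.
have b0 : b = 0.
  apply: (@le_linear_eq0 _ _ (C * r + `|c|) r) => // s sr.
  have s0 : 0 < s by case/andP: sr.
  rewrite -(ler_pM2l s0) -{1}(gtr0_norm s0) -normrM.
  apply: le_trans (tri (s * b) (s ^+ 2 * c)) _; rewrite mulrDl mulrDr lerD //.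
    have := h s sr; rewrite a0 add0r => /le_trans; apply.
    rewrite (_ : s * (C * r * s) = C * (r * s ^+ 2)); last by ring.
    by rewrite ler_wpM2l // exprS ler_wpM2r ?exprn_ge0 ?ltW //; case/andP: sr.
  by rewrite normrM (gtr0_norm (exprn_gt0 2 s0)) expr2 -mulrA (mulrC `|c|).
split=> //; apply: (@le_linear_eq0 _ _ C r) => // s sr.
have s0 : 0 < s by case/andP: sr.
have s20 : 0 < s ^+ 2 by rewrite exprn_gt0.
rewrite -(ler_pM2l s20) -{1}(gtr0_norm s20) -normrM.
have := h s sr; rewrite a0 b0 add0r mulr0 add0r => /le_trans; apply.
by rewrite exprSr mulrCA.
Qed.

End RealBounds.

(** * Surface identities for a bulk field with O(s^2) slip and divergence defects *)

Section LimitEquations.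
Context {R : realType} (T delta : R) (Gam : R -> set (vec R)).
Context (nu : spacetime R -> vec R) (VN : spacetime R -> R).
Context (proj : spacetime R -> vec R) (d : spacetime R -> R).

Local Notation N r := (tube `]0, T[ (tubular_nbhd r Gam)).
Local Notation ST := (tube `]0, T[ Gam).
Local Notation ray := (ray nu).

Context (mG : moving_surface T Gam) (uN : outward_unit_normal T Gam nu).
Context (nV : normal_velocity T Gam nu VN).
Context (tc : tubular_coordinates T delta Gam nu proj d) (delta0 : 0 < delta).
Context (U : 'I_3 -> spacetime R -> R).
Context (CU : forall k, Cinf (N delta) (U k)).

Let oN : open (N delta) := open_tube mG (r := delta).

(** Twice the strain tensor, entry by entry; the factor 1/2 returns in [surface_strain]. *)
Definition strain2 i j z := pdx i (U j) z + pdx j (U i) z.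

Lemma Cinf_pdx (f : spacetime R -> R) i :
  Cinf (N delta) f -> Cinf (N delta) (pdx i f).
Proof. by move=> Cf; exact: (Cinf_iter_pd [:: Some i] Cf). Qed.

Lemma Cinf_strain2 i j : Cinf (N delta) (strain2 i j).
Proof. by move=> n; apply: CkD => //; apply: Cinf_pdx. Qed.

Lemma Cinf_differentiable (f : spacetime R -> R) z :
  Cinf (N delta) f -> N delta z -> differentiable f z.
Proof. by move=> /(_ 1) [df _] zN; exact: df. Qed.

Lemma derive_combination n (c : 'I_n -> R) (f : 'I_n -> spacetime R -> R) z e :
  (forall i, differentiable (f i) z) ->
  'D_e (fun w => \sum_(i < n) c i * f i w) z = \sum_(i < n) c i * 'D_e (f i) z.
Proof.
move=> df; have -> : (fun w => \sum_(i < n) c i * f i w) =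
    \sum_(i < n) (c i \*: f i).
  by apply/funext => w; rewrite fct_sumE.
rewrite derive_sum => [|i]; last exact/derivableZ/diff_derivable.
by apply: eq_bigr => i _; rewrite deriveZ //; exact: diff_derivable.
Qed.

Lemma ray_quadratic_bound (f : spacetime R -> R) z C r :
  Cinf (N delta) f -> ST z -> 0 < r ->
  (forall s, 0 < s < r -> `|f (ray z s)| <= C * s ^+ 2) ->
  f z = 0 /\ 'D_(nu z, 0) f z = 0.
Proof.
move=> Cf zS r0 fC.
have df : differentiable f (ray z 0).
  by rewrite ray0; apply: Cinf_differentiable => //; exact: (ST_tube uN tc).
have [] := quadratic_bound_eq0 r0 (differentiable_ray df) fC.
by rewrite derive_ray ray0.
Qed.

(** This allows [v], known only on the surface, to be exchanged for the bulk field [U] under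
    tangential derivatives. *)
Lemma pdtan_eq (f g : spacetime R -> R) z i :
  ST z -> (forall w, ST w -> f w = g w) ->
  pdtan nu proj i f z = pdtan nu proj i g z.
Proof.
move=> zS fg; rewrite /pdtan /tgrad; congr ((_ *m _) _ _).
apply/matrixP => k j; rewrite !mxE; apply: near_eq_derive.
apply: (open_near oN); first exact: (ST_tube uN tc).
by move=> w wN; exact: (ext_eq tc).
Qed.

Context (UVN : forall z s, ST z -> `|s| < delta ->
  \sum_(k < 3) nu z k 0 * U k (ray z s) = VN z).

(** The normal component of [U] is constant along the ray and the weights are frozen. The identity
    is needed at every height, since the slip condition is read off the surface. *)
Lemma normal_derivative_orth z s : ST z -> `|s| < delta ->
  \sum_(k < 3) nu z k 0 * 'D_(nu z, 0) (U k) (ray z s) = 0.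
Proof.
move=> zS sd; have zN : N delta (ray z s) by exact: (ray_tube uN tc).
have dU k : differentiable (U k) (ray z s) by exact: Cinf_differentiable.
rewrite -(derive_combination (fun k => nu z k 0) _ dU) -derive_ray.
rewrite (near_eq_derive (g := fun=> VN z)) ?derive_cst //.
have : \forall s' \near s, `|s'| < delta.
  have cn : {for s, continuous (fun s' : R => `|s'|)} by exact: norm_continuous.
  by apply: cvgr_lt cn _ sd.
by apply: filterS => s' s'd; exact: UVN.
Qed.

Context (slip : forall z j, ST z -> exists C r, 0 < r /\
  forall s, 0 < s < r ->
    `|\sum_(i < 3) nu z i 0 * strain2 i j (ray z s)| <= C * s ^+ 2).
Context (divU : forall z, ST z -> exists C r, 0 < r /\
  forall s, 0 < s < r ->
    `|\sum_(i < 3) pdx i (U i) (ray z s)| <= C * s ^+ 2).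

Lemma strain2_normal z j : ST z ->
  \sum_(i < 3) nu z i 0 * strain2 i j z = 0 /\
  \sum_(i < 3) nu z i 0 * 'D_(nu z, 0) (strain2 i j) z = 0.
Proof.
move=> zS; have zN : N delta z by exact: (ST_tube uN tc).
have [C [r [r0 hC]]] := slip j zS.
have Cc : Cinf (N delta) (fun w => \sum_(i < 3) nu z i 0 * strain2 i j w).
  move=> n; apply: Ck_sum => // i; apply: CkM => //; first exact: Ck_cst.
  exact: Cinf_strain2.
have [h0] := ray_quadratic_bound Cc zS r0 hC.
rewrite derive_combination // => i.
by apply: Cinf_differentiable => //; exact: Cinf_strain2.
Qed.

(** All first derivatives of div U vanish on the surface: the tangential ones because div U is zero
    there, the normal one by the quadratic bound; [pdx_ext] combines the two. *)
Lemma divergence_ST z : ST z ->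
  \sum_(i < 3) pdx i (U i) z = 0 /\
  forall j, \sum_(i < 3) pdx j (pdx i (U i)) z = 0.
Proof.
pose f w := \sum_(i < 3) pdx i (U i) w.
have Cf : Cinf (N delta) f.
  by move=> n; apply: Ck_sum => // i; exact: Cinf_pdx.
have f0 w : ST w -> f w = 0 /\ 'D_(nu w, 0) f w = 0.
  move=> wS; have [C [r [r0 hC]]] := divU wS.
  exact: (ray_quadratic_bound Cf wS r0 hC).
move=> zS; have zN : N delta z by exact: (ST_tube uN tc).
split=> [|j]; first by have [] := f0 z zS.
have := pdx_ext mG uN tc delta0 j zS (Cinf_differentiable Cf zN).
have [_ ->] := f0 z zS; rewrite mulr0 subr0.
rewrite {1}/pdx (near_eq_derive (g := fun=> 0)); last first.
  apply: (open_near oN zN) => w wN.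
  by rewrite (ext_eq tc (g := fun=> 0)) // => w' w'S; have [] := f0 w' w'S.
rewrite derive_cst => fj; apply: etrans (esym fj).
have -> : f = (fun w => \sum_(i < 3) 1 * pdx i (U i) w).
  by apply/funext => w; apply: eq_bigr => i _; rewrite mul1r.
rewrite /pdx derive_combination => [|i]; last first.
  by apply: Cinf_differentiable => //; exact: Cinf_pdx.
by apply: eq_bigr => i _; rewrite mul1r.
Qed.

Context (v : spacetime R -> vec R).
Context (vU : forall z k, ST z -> v z k 0 = U k z).

Lemma tdiv_ST z : ST z -> tdiv nu proj v z = 0.
Proof.
move=> zS; have zN : N delta z by exact: (ST_tube uN tc).
have -> : tdiv nu proj v z =
    \sum_(i < 3) (pdx i (U i) z - nu z i 0 * 'D_(nu z, 0) (U i) z).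
  apply: eq_bigr => i _; rewrite (pdtan_eq i zS (fun w wS => vU i wS)).
  exact: (pdtan_ST mG uN tc delta0 i zS (Cinf_differentiable (CU i) zN)).
rewrite sumrB; have [-> _] := divergence_ST zS; rewrite sub0r.
have := @normal_derivative_orth z 0 zS; rewrite normr0 ray0 => -> //.
by rewrite oppr0.
Qed.

(** With E the full gradient and P the projector, [tgradv] is P E. Idempotence of P reduces the left
    side to half of P (E + E^T) P, and this symmetric matrix annihilates [nu], so P fixes it on both
    sides. *)
Lemma surface_strain z : ST z ->
  PGam nu z *m tstrain nu proj v z *m PGam nu z =
  \matrix_(i, j) (2^-1 * strain2 i j z).
Proof.
move=> zS; have zN : N delta z by exact: (ST_tube uN tc).
pose E : 'M[R]_3 := \matrix_(i, j) pdx i (U j) z.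
pose P := PGam nu z.
have nn : (nu z)^T *m nu z = 1%:M.
  apply/matrixP => i j; rewrite !ord1 !mxE -(ST_unit uN zS) eqxx mulr1n.
  by apply: eq_bigr => k _; rewrite !mxE.
have PT : P^T = P by rewrite /P /PGam linearB /= trmx1 trmx_mul trmxK.
have PP : P *m P = P.
  rewrite /P /PGam mulmxBl mul1mx mulmxBr mulmx1.
  by rewrite mulmxA -(mulmxA (nu z)) nn mulmx1 subrr subr0.
have tg : tgradv nu proj v z = P *m E.
  apply/matrixP => i j; rewrite [LHS]mxE (pdtan_eq i zS (fun w wS => vU j wS)).
  rewrite (pdtan_ST mG uN tc delta0 i zS (Cinf_differentiable (CU j) zN)).
  rewrite (derive_normal _ _ (Cinf_differentiable (CU j) zN)).
  rewrite /P /PGam mulmxBl mul1mx -mulmxA !mxE big_ord1 !mxE.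
  by congr (_ - _ * _); apply: eq_bigr => k _; rewrite !mxE.
pose D := E + E^T.
have DE i j : D i j = strain2 i j z by rewrite !mxE.
have DT : D^T = D by rewrite /D linearD /= trmxK addrC.
have nD : (nu z)^T *m D = 0.
  apply/matrixP => i j; rewrite ord1 mxE [RHS]mxE.
  have [sn _] := strain2_normal j zS; apply: etrans sn.
  by apply: eq_bigr => k _; rewrite DE mxE.
have Dn : D *m nu z = 0 by rewrite -[LHS]trmxK trmx_mul DT nD trmx0.
have PD : P *m D = D by rewrite /P /PGam mulmxBl mul1mx -mulmxA nD mulmx0 subr0.
have DP : D *m P = D by rewrite /P /PGam mulmxBr mulmx1 mulmxA Dn mul0mx subr0.
have key : P *m (P *m E + E^T *m P) *m P = D.
  rewrite mulmxDr mulmxDl (mulmxA P P) PP -(mulmxA P (E^T *m P)) -(mulmxA E^T).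
  by rewrite PP (mulmxA P E^T) -mulmxDl -mulmxDr PD DP.
rewrite /tstrain tg -/P trmx_mul PT -scalemxAr -scalemxAl key.
by apply/matrixP => i j; rewrite !mxE.
Qed.

Lemma tdivm_ST z j : ST z ->
  2 * tdivm nu proj
    (fun w => PGam nu w *m tstrain nu proj v w *m PGam nu w) z j 0 =
  \sum_(i < 3) pdx i (pdx i (U j)) z.
Proof.
move=> zS; have zN : N delta z by exact: (ST_tube uN tc).
have dS i : differentiable (strain2 i j) z.
  by apply: Cinf_differentiable => //; exact: Cinf_strain2.
have dp i k : differentiable (pdx i (U k)) z.
  by apply: Cinf_differentiable => //; exact: Cinf_pdx.
have half (a b c : R) : 2 * (2^-1 * a - c * (2^-1 * b)) = a - c * b by field.
rewrite mxE mulr_sumr.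
have -> : \sum_(i < 3) 2 * pdtan nu proj i (fun w => (PGam nu w *m
      tstrain nu proj v w *m PGam nu w) i j) z =
    \sum_(i < 3) (pdx i (strain2 i j) z -
      nu z i 0 * 'D_(nu z, 0) (strain2 i j) z).
  apply: eq_bigr => i _.
  (* The identity for the projected strain holds on the surface only, which is all that a tangential
     derivative sees. *)
  rewrite (@pdtan_eq _ (fun w => 2^-1 * strain2 i j w)) //; last first.
    by move=> w wS; rewrite surface_strain // mxE.
  have dh : differentiable (fun w => 2^-1 * strain2 i j w) z.
    exact: differentiableZ.
  have dZ e : 'D_e (fun w => 2^-1 * strain2 i j w) z =
      2^-1 * 'D_e (strain2 i j) z.
    by apply: deriveZ; exact: diff_derivable.
  rewrite (pdtan_ST mG uN tc delta0 i zS dh) /pdx !dZ.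
  exact: half.
have [_ sn] := strain2_normal j zS; rewrite sumrB sn subr0.
have -> : \sum_(i < 3) pdx i (strain2 i j) z =
    \sum_(i < 3) (pdx i (pdx i (U j)) z + pdx i (pdx j (U i)) z).
  apply: eq_bigr => i _; apply: deriveD; apply: diff_derivable; exact: dp.
have [_ /(_ j) dv] := divergence_ST zS.
(* Exchanging the derivatives turns the sum into the j-th derivative of the divergence. *)
have dv' : \sum_(i < 3) pdx i (pdx j (U i)) z = 0.
  apply: etrans dv; apply: eq_bigr => i _.
  exact: (derive_comm _ _ oN (CU i 2) zN).
by rewrite big_split /= dv' addr0.
Qed.

(** The time derivative of the extension gains [VN] times the normal derivative of [U], and
    advection loses (U.n) times the same quantity; they cancel because U.n = [VN]. *)
Lemma material_derivative_ST z j : ST z ->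
  (forall k, smooth_on (closure ST) (fun z => v z k 0)) ->
  material_derivative proj v v z j 0 =
  pdt (U j) z + \sum_(i < 3) U i z * pdx i (U j) z.
Proof.
move=> zS sv; have zN : N delta z by exact: (ST_tube uN tc).
have dU : differentiable (U j) z by exact: Cinf_differentiable.
have Cv : Cinf (N delta) (ext proj v).
  by move=> n; apply: Ck_col => // k; exact: (Cinf_ext mG tc (sv k)).
have extE e : 'D_e (ext proj (fun w => v w j 0)) z = 'D_e (ext proj (U j)) z.
  apply: near_eq_derive; apply: (open_near oN zN) => w wN.
  by apply: (ext_eq tc wN) => w' w'S; exact: vU.
have [dv _] := Cv 1.
rewrite /material_derivative mxE {1}/pdt (derive_entry _ _ _ (dv z zN)) extE.
rewrite -/(pdt _ _) (pdt_ext mG uN nV tc delta0 zS dU) [X in _ + X]mxE.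
rewrite -addrA; congr (_ + _).
have -> : \sum_(i < 3) v z i 0 * pdx i (fun w => ext proj v w j 0) z =
    \sum_(i < 3) (U i z * pdx i (U j) z -
      nu z i 0 * U i z * 'D_(nu z, 0) (U j) z).
  apply: eq_bigr => i _; rewrite vU // /pdx extE -/(pdx _ _ _).
  rewrite (pdx_ext mG uN tc delta0 i zS dU) mulrBr mulrA.
  by rewrite (mulrC (U i z) (nu z i 0)).
rewrite sumrB -mulr_suml.
have := @UVN z 0 zS; rewrite normr0 ray0 => -> //.
by rewrite addrCA subrr addr0.
Qed.

End LimitEquations.

(** * Truncated expansions and boundary data at the ray endpoint *)

Section Expansions.
Context {R : realType} (T delta : R) (Gam : R -> set (vec R)).
Context (nu : spacetime R -> vec R) (VN : spacetime R -> R).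
Context (proj : spacetime R -> vec R) (d : spacetime R -> R) (eps0 : R).

Local Notation N r := (tube `]0, T[ (tubular_nbhd r Gam)).
Local Notation ST := (tube `]0, T[ Gam).
Local Notation ray := (ray nu).

Context (mG : moving_surface T Gam) (uN : outward_unit_normal T Gam nu).
Context (tc : tubular_coordinates T delta Gam nu proj d).
Context (eps0d : 0 < eps0 < delta).

Definition approx n (g : 'I_n -> spacetime R -> R) (z : spacetime R) : R :=
  \sum_(j < n) d z ^+ j * ext proj (g j) z.

Lemma Cinf_approx n (g : 'I_n -> spacetime R -> R) :
  (forall j, smooth_on (closure ST) (g j)) -> Cinf (N delta) (approx g).
Proof.
move=> sg m; have oN := open_tube mG (r := delta).
apply: Ck_sum => // j; apply: CkM => //; last exact: (Cinf_ext mG tc).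
by apply: CkX => //; exact: (Cinf_d mG tc).
Qed.

Lemma approx_ray n (g : 'I_n -> spacetime R -> R) z s : ST z -> `|s| < delta ->
  approx g (ray z s) = \sum_(j < n) s ^+ j * g j z.
Proof.
move=> zS sd; apply: eq_bigr => j _; rewrite (ext_ray uN tc) //.
by have [_ -> _] := ray_coordinates uN tc zS sd.
Qed.

(** Iterated derivatives commute with taking an entry only for smooth functions, so the
    vector-valued remainder is first shown to be smooth. *)
Lemma expansion_entry n (u : R -> spacetime R -> vec R)
    (g : 'I_n -> spacetime R -> vec R) k :
  (forall eps, 0 < eps < eps0 -> smooth_near (closure (N eps)) (u eps)) ->
  expansion T eps0 Gam proj d u g ->
  remainder T eps0 Gam d n
    (fun eps z => u eps z k 0 - approx (fun j w => g j w k 0) z).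
Proof.
move=> su [sg rem]; have [e00 e0d] := andP eps0d.
have gE z i : (\sum_(j < n) d z ^+ j *: ext proj (g j) z) i 0 =
    approx (fun j w => g j w i 0) z.
  by rewrite summxE; apply: eq_bigr => j _; rewrite mxE.
have Cr eps : 0 < eps < eps0 -> Cinf (N eps)
    (fun z => u eps z - \sum_(j < n) d z ^+ j *: ext proj (g j) z).
  move=> epsP m; have oN := open_tube mG (r := eps).
  have [W [oW cW Wu]] := su _ epsP.
  apply: Ck_col => // i.
  apply: (@Ck_eq _ _ _ _ _
    (fun z => u eps z i 0 - approx (fun j w => g j w i 0) z)) => //.
    by move=> z _; rewrite -gE !mxE.
  apply: CkB => //.
    apply: Ck_entry => //; apply: Ck_subset (Wu m).
    by move=> z zN; apply/cW/subset_closure.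
  have : Cinf (N delta) (approx (fun j w => g j w i 0)).
    by apply: Cinf_approx => j; exact: smooth_on_entry.
  move=> /(_ m); apply: Ck_subset; apply: tube_subset.
  by case/andP: epsP => _ /ltW /le_trans; apply; exact: ltW.
have [C hC] := remainder_entry mG k 0 Cr rem; exists C => eps z l epsP zN ln.
have -> : (fun z => u eps z k 0 - approx (fun j w => g j w k 0) z) =
    (fun z => (u eps z - \sum_(j < n) d z ^+ j *: ext proj (g j) z) k 0).
  by apply/funext => w; rewrite -gE !mxE.
exact: hC.
Qed.

Lemma ST_nu_le1 z i : ST z -> `|nu z i 0| <= 1.
Proof.
move=> zS; rewrite -[leRHS](@normr1 R) -ler_sqr ?nnegrE // !real_normK ?num_real //.
rewrite expr1n -(ST_unit uN zS) /dot (bigD1 i) //= -expr2 lerDl.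
by apply: sumr_ge0 => k _; rewrite -expr2 sqr_ge0.
Qed.

Lemma combination_bound (c : vec R) (x y : 'I_3 -> R) (B : R) :
  (forall i, `|c i 0| <= 1) -> (forall i, `|x i - y i| <= B) ->
  `|\sum_(i < 3) c i 0 * x i - \sum_(i < 3) c i 0 * y i| <= 3 * B.
Proof.
move=> c1 xy; rewrite -sumrB; apply: le_trans (ler_norm_sum _ _ _) _.
rewrite -[3]/(3%:R : R) mulr_natl.
have -> : B *+ 3 = \sum_(i < 3) B by rewrite sumr_const card_ord.
apply: ler_sum => i _; rewrite -mulrBr normrM -[leRHS]mul1r.
by apply: ler_pM.
Qed.

(** Meant for x = 2 D(U)n and y = 2 D(u)n with c = n. The slip condition makes y parallel to n. As x
    has no normal component, that of y is at most 3 B, so |y j| <= 3 B, and the difference x - y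
    adds one more B. *)
Lemma tangential_bound (c : vec R) (x y : 'I_3 -> R) (B : R) j :
  (forall i, `|c i 0| <= 1) -> (forall i, `|x i - y i| <= B) ->
  \sum_(i < 3) c i 0 * x i = 0 -> y j = (\sum_(i < 3) c i 0 * y i) * c j 0 ->
  `|x j| <= 4 * B.
Proof.
move=> c1 xy cx yj; have cb := combination_bound c1 xy.
rewrite cx sub0r normrN in cb.
rewrite -(subrK (y j) (x j)) [4](_ : _ = 1 + 3); last by ring.
rewrite mulrDl mul1r; apply: le_trans (ler_normD _ _) _; apply: lerD => //.
rewrite yj normrM; apply: le_trans cb; rewrite -[leRHS]mulr1.
by apply: ler_wpM2l.
Qed.

Lemma nu_eps_ray z s : ST z -> 0 < s < delta -> nu_eps nu proj d (ray z s) = nu z.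
Proof.
move=> zS /andP[s0 sd]; have sd' : `|s| < delta by rewrite gtr0_norm.
rewrite /nu_eps; have [_ -> _] := ray_coordinates uN tc zS sd'.
by rewrite gtr0_sg // scale1r; exact: (ext_ray uN tc).
Qed.

Lemma VN_eps_ray z s : ST z -> 0 < s < delta -> VN_eps VN proj d (ray z s) = VN z.
Proof.
move=> zS /andP[s0 sd]; have sd' : `|s| < delta by rewrite gtr0_norm.
rewrite /VN_eps; have [_ -> _] := ray_coordinates uN tc zS sd'.
by rewrite gtr0_sg // mul1r; exact: (ext_ray uN tc).
Qed.

Lemma ray_boundary_tube z s : ST z -> 0 < s < delta ->
  tube `]0, T[ (fun t => boundary (tubular_nbhd s Gam t)) (ray z s).
Proof.
move=> zS sd; have := ray_boundary uN tc zS sd.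
by case: zS => zT _; rewrite rayE => b; split.
Qed.

End Expansions.

Theorem theorem4p1 (R : realType) (T delta : R) (Gam : R -> set (vec R))
    (nu : spacetime R -> vec R) (VN : spacetime R -> R)
    (proj : spacetime R -> vec R) (d : spacetime R -> R)
    (mu0 eps0 : R)
    (u : R -> spacetime R -> vec R) (p : R -> spacetime R -> R)
    (v v1 v2 : spacetime R -> vec R) (q q1 : spacetime R -> R) :
  0 < T -> 0 < delta ->
  moving_surface T Gam ->
  outward_unit_normal T Gam nu ->
  normal_velocity T Gam nu VN ->
  tubular_coordinates T delta Gam nu proj d ->
  0 < mu0 -> 0 < eps0 < delta ->
  (forall eps : R, 0 < eps < eps0 ->
    [/\ smooth_near (closure (tube `]0, T[ (tubular_nbhd eps Gam))) (u eps),
        smooth_near (closure (tube `]0, T[ (tubular_nbhd eps Gam))) (p eps) &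
        navier_stokes_slip T mu0 eps Gam nu VN proj d (u eps) (p eps)]) ->
  expansion T eps0 Gam proj d u (fun j : 'I_3 => nth v [:: v; v1; v2] j) ->
  expansion T eps0 Gam proj d p (fun j : 'I_2 => nth q [:: q; q1] j) ->
  (forall z, tube `]0, T[ Gam z -> dot (v z) (nu z) = VN z) /\
  (forall z, tube `]0, T[ Gam z ->
    material_derivative proj v v z + tgrad nu proj q z + q1 z *: nu z =
      (2 * mu0) *: tdivm nu proj
        (fun z' => PGam nu z' *m tstrain nu proj v z' *m PGam nu z') z) /\
  (forall z, tube `]0, T[ Gam z -> tdiv nu proj v z = 0).
Proof.
move=> T0 delta0 mG uN nV tc mu0_gt0 eps0d ns expu expp.
have [e00 e0d] := andP eps0d.
set N := fun r => tube `]0, T[ (tubular_nbhd r Gam).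
set ST := tube `]0, T[ Gam.
have oN r : open (N r) by exact: open_tube.
have su eps : 0 < eps < eps0 -> smooth_near (closure (N eps)) (u eps).
  by case/ns.
have sp eps : 0 < eps < eps0 -> smooth_near (closure (N eps)) (p eps).
  by case/ns.
pose g (j : 'I_3) := nth v [:: v; v1; v2] j.
pose U k := approx proj d (fun j w => g j w k 0).
have sg j k : smooth_on (closure ST) (fun w => g j w k 0).
  by apply: smooth_on_entry; have [sgj _] := expu; exact: sgj.
have CU k : Cinf (N delta) (U k) by apply: (Cinf_approx mG tc) => j; exact: sg.
have su_k k eps : 0 < eps < eps0 ->
    smooth_near (closure (N eps)) (fun z => u eps z k 0).
  move=> /su [W [oW cW Wu]]; exists W; split => // n.
  exact: Ck_entry.
have remu k : remainder T eps0 Gam d 3 (fun eps z => u eps z k 0 - U k z).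
  exact: (expansion_entry mG tc eps0d k su expu).
(* The constants are fixed before [eps], because the thickness is later taken equal to the height
   s. *)
have /choice [C hC] : forall k, exists C, 0 <= C /\ forall eps z s l,
    0 < eps < eps0 -> ST z -> 0 <= s <= eps -> (size l <= 3)%N ->
    `|iter_pd l (fun z => u eps z k 0) (ray nu z s) -
      iter_pd l (U k) (ray nu z s)| <= C * s ^+ (3 - size l).
  move=> k; have [C C0 hC] := remainder_ray mG uN tc eps0d (CU k) (su_k k) (remu k).
  by exists C.
pose K := \sum_(k < 3) C k.
have C0 k : 0 <= C k by have [] := hC k.
have K0 : 0 <= K by apply: sumr_ge0 => k _.
have CK k : C k <= K by rewrite /K (bigD1 k) //= lerDl sumr_ge0.
have bound k eps z s l : 0 < eps < eps0 -> ST z -> 0 <= s <= eps ->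
    (size l <= 3)%N ->
    `|iter_pd l (U k) (ray nu z s) -
      iter_pd l (fun z => u eps z k 0) (ray nu z s)| <= K * s ^+ (3 - size l).
  move=> epsP zS sP l3; have [_ h] := hC k; rewrite distrC.
  apply: le_trans (h _ _ _ _ epsP zS sP l3) _; rewrite ler_wpM2r // exprn_ge0 //.
  by case/andP: sP.
have lt_d s : 0 < s < eps0 -> 0 < s < delta.
  by move=> /andP[-> /lt_trans]; apply.
have self s : 0 < s < eps0 -> 0 <= s <= s by case/andP=> /ltW -> _ /=.
have UE k z s : ST z -> `|s| < delta ->
    U k (ray nu z s) = v z k 0 + s * v1 z k 0 + s ^+ 2 * v2 z k 0.
  move=> zS sd; rewrite /U (approx_ray uN tc) // !big_ord_recl big_ord0 /=.
  by rewrite mul1r addr0 addrA.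
have sumUE z s : ST z -> `|s| < delta ->
    \sum_(k < 3) nu z k 0 * U k (ray nu z s) = \sum_(k < 3) nu z k 0 * v z k 0 +
      s * (\sum_(k < 3) nu z k 0 * v1 z k 0) +
      s ^+ 2 * (\sum_(k < 3) nu z k 0 * v2 z k 0).
  move=> zS sd; rewrite !mulr_sumr -!big_split /=.
  by apply: eq_bigr => k _; rewrite UE //; ring.
have coef z : ST z -> [/\ \sum_(k < 3) nu z k 0 * v z k 0 - VN z = 0,
    \sum_(k < 3) nu z k 0 * v1 z k 0 = 0 & \sum_(k < 3) nu z k 0 * v2 z k 0 = 0].
  (* The solution of thickness s is used at height s, where the ray meets its boundary. The solution
     changes with s, but the polynomial compared with it does not. The factor 3 counts the
     components. *)
  move=> zS; apply: (@cubic_bound_eq0 _ _ _ _ (3 * K) eps0) => // s sP.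
  have sd := lt_d s sP; have sd' : `|s| < delta.
    by case/andP: sd => s0 ?; rewrite gtr0_norm.
  have [_ _ nss] := ns s sP.
  have := ns_impermeable nss (ray_boundary_tube uN tc zS sd).
  rewrite (nu_eps_ray uN tc zS sd) (VN_eps_ray VN uN tc zS sd) => imp.
  rewrite addrAC -addrA addrAC addrA (addrAC (\sum_(k < 3) _)) -sumUE // -imp.
  rewrite -mulrA /dot (eq_bigr _ (fun k _ => mulrC (u s (ray nu z s) k 0) _)).
  apply: combination_bound => k; first exact: (ST_nu_le1 uN).
  exact: (bound k s z s [::] sP zS (self s sP) isT).
have UVN z s : ST z -> `|s| < delta ->
    \sum_(k < 3) nu z k 0 * U k (ray nu z s) = VN z.
  move=> zS sd; have [/eqP + c1 c2] := coef z zS.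
  by rewrite subr_eq0 sumUE // c1 c2 !mulr0 !addr0 => /eqP.
have vU z k : ST z -> v z k 0 = U k z.
  by move=> zS; rewrite -{2}(ray0 nu z) UE ?normr0 // expr0n !mul0r !addr0.
have dU k z : N delta z -> differentiable (U k) z.
  by move=> zN; apply: (Cinf_differentiable (CU k)).
have slip z j : ST z -> exists C r, 0 < r /\ forall s, 0 < s < r ->
    `|\sum_(i < 3) nu z i 0 * strain2 U i j (ray nu z s)| <= C * s ^+ 2.
  (* 2 for the two gradient terms of the strain, 3 for the contraction with the normal, 4 from
     [tangential_bound]. *)
  move=> zS; exists (4 * (3 * (2 * K))), eps0; split => // s sP.
  have sd := lt_d s sP; have sd' : `|s| < delta.
    by case/andP: sd => s0 ?; rewrite gtr0_norm.
  have wN : N delta (ray nu z s) by exact: (ray_tube uN tc).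
  have [_ _ nss] := ns s sP.
  have := ns_slip nss (ray_boundary_tube uN tc zS sd).
  rewrite (nu_eps_ray uN tc zS sd); set w := ray nu z s => slip.
  pose us i j w := pdx i (fun z => u s z j 0) w + pdx j (fun z => u s z i 0) w.
  pose y j := \sum_(i < 3) nu z i 0 * us i j w.
  have yE k : (strain (u s) w *m nu z) k 0 = 2^-1 * y k.
    rewrite mxE mulr_sumr; apply: eq_bigr => i _; rewrite !mxE /us.
    by rewrite (addrC (pdx k _ _)) -mulrA (mulrC (nu z i 0)).
  have n1 i : `|nu z i 0| <= 1 by exact: (ST_nu_le1 uN).
  rewrite -!mulrA; apply: (@tangential_bound _ (nu z)
    (fun j => \sum_(i < 3) nu z i 0 * strain2 U i j w) y) => //.
  - move=> k; apply: combination_bound => // i.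
    rewrite /strain2 /us opprD addrACA [2 * _]mulrDl !mul1r.
    apply: le_trans (ler_normD _ _) _; apply: lerD.
      exact: (bound k s z s [:: Some i] sP zS (self s sP) isT).
    exact: (bound i s z s [:: Some k] sP zS (self s sP) isT).
  (* The double contraction of the strain with the normal is a sum of two terms that agree after
     exchanging indices, and each is the normal derivative of U.n. *)
  - have orth := normal_derivative_orth uN tc CU UVN zS sd'.
    rewrite -/w in orth.
    have oE : \sum_(k < 3) \sum_(i < 3) nu z k 0 * (nu z i 0 * pdx i (U k) w) = 0.
      apply: etrans orth; apply: eq_bigr => k _.
      by rewrite (derive_normal _ _ (dU k w wN)) mulr_sumr.
    have -> : \sum_(k < 3) nu z k 0 * \sum_(i < 3) nu z i 0 * strain2 U i k w =
        \sum_(k < 3) \sum_(i < 3) nu z k 0 * (nu z i 0 * pdx i (U k) w) +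
        \sum_(k < 3) \sum_(i < 3) nu z k 0 * (nu z i 0 * pdx k (U i) w).
      rewrite -big_split; apply: eq_bigr => k _; rewrite mulr_sumr -big_split.
      by apply: eq_bigr => i _; rewrite /strain2 !mulrDr.
    rewrite oE add0r exchange_big /=; apply: etrans oE.
    by apply: eq_bigr => i _; apply: eq_bigr => k _; rewrite mulrCA.
  - move: slip yE; move: (strain (u s) w *m nu z) => Sn slip yE.
    have := congr1 (fun M : vec R => M j 0) slip; rewrite /tan_part !mxE.
    have -> : dot Sn (nu z) = 2^-1 * \sum_(i < 3) nu z i 0 * y i.
      by rewrite mulr_sumr; apply: eq_bigr => i _; rewrite yE -mulrA (mulrC (y i)).
    move=> /eqP; rewrite subr_eq0 yE -mulrA => /eqP; apply: mulfI.
    by rewrite invr_eq0 pnatr_eq0.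
(* Any admissible thickness serves for the bulk equations. *)
have eps1P : 0 < eps0 / 2 < eps0.
  by rewrite divr_gt0 // gtr_pMr // invf_lt1 // ltr1n.
have [eps1_gt0 eps1_lt] := andP eps1P.
have eps1d : eps0 / 2 < delta by exact: lt_trans eps1_lt e0d.
have [_ _ ns1] := ns _ eps1P.
have divU z : ST z -> exists C r, 0 < r /\ forall s, 0 < s < r ->
    `|\sum_(i < 3) pdx i (U i) (ray nu z s)| <= C * s ^+ 2.
  move=> zS; exists (3 * K), (eps0 / 2); split => // s /andP[s0 s1].
  have wN : N (eps0 / 2) (ray nu z s).
    by apply: (ray_tube uN tc zS); [rewrite gtr0_norm|exact: ltW].
  (* Weights all equal to 1 turn [combination_bound] into an estimate of the trace. *)
  have c1 i : `|(const_mx 1 : vec R) i 0| <= 1 by rewrite mxE normr1.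
  have s1' : 0 <= s <= eps0 / 2 by rewrite !ltW.
  have xy i : `|pdx i (U i) (ray nu z s) -
      pdx i (fun z => u (eps0 / 2) z i 0) (ray nu z s)| <= K * s ^+ 2.
    exact: (bound i _ z s [:: Some i] eps1P zS s1' isT).
  have := combination_bound c1 xy; under eq_bigr => i _ do rewrite mxE mul1r.
  rewrite -mulrA [X in _ - X](_ : _ = 0) ?subr0 //.
  apply: etrans (ns_incompressible ns1 wN).
  by apply: eq_bigr => i _; rewrite mxE mul1r.
split; [|split].
- move=> z zS; have [/eqP + _ _] := coef z zS; rewrite subr_eq0 => /eqP <-.
  by apply: eq_bigr => k _; rewrite mulrC.
- move=> z zS; apply/matrixP => j k; rewrite ord1 {k}.
  have zN : N delta z by exact: (ST_tube uN tc).
  have zN1 : N (eps0 / 2) z by apply: (ST_tube uN tc) => //; exact: ltW.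
  pose Q := approx proj d (fun j : 'I_2 => nth q [:: q; q1] j).
  have [sq remp] := expp.
  have CQ : Cinf (N delta) Q by exact: (Cinf_approx mG tc).
  have agree_u k l : (size l < 3)%N ->
      iter_pd l (fun w => u (eps0 / 2) w k 0) z = iter_pd l (U k) z.
    exact: (remainder_ST mG uN tc eps0d (CU k) (su_k k) (remu k) eps1P zS).
  have agree_p : pdx j (p (eps0 / 2)) z = pdx j Q z.
    exact: (remainder_ST (l := [:: Some j]) mG uN tc eps0d CQ sp remp eps1P zS).
  have addE (A B D : vec R) : (A + B + D) j 0 = A j 0 + B j 0 + D j 0.
    by rewrite !mxE.
  have scaleE (c : R) (A : vec R) : (c *: A) j 0 = c * A j 0 by rewrite mxE.
  have dQ : differentiable Q z by exact: (Cinf_differentiable CQ zN).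
  (* Along the ray Q is the affine function q + s q1, with slope [q1]. *)
  have dnQ : 'D_(nu z, 0) Q z = q1 z.
    rewrite -{1}(ray0 nu z) -derive_ray.
    rewrite (near_eq_derive (g := fun s : R => q z + s *: q1 z)); last first.
      have cn : {for 0 : R, continuous (fun s : R => `|s|)}.
        exact: norm_continuous.
      have d0 : `|0 : R| < delta by rewrite normr0.
      have : \forall s \near (0 : R), `|s| < delta by apply: cvgr_lt cn _ d0.
      apply: filterS => s sd; rewrite /Q (approx_ray uN tc) //.
      by rewrite !big_ord_recl big_ord0 /= mul1r addr0.
    by rewrite (derive_affine (fun x : R => x)) derive_id scale1r.
  have qQ w : ST w -> q w = Q w.
    move=> wS; rewrite -{2}(ray0 nu w) /Q (approx_ray uN tc) ?normr0 //.
    by rewrite !big_ord_recl big_ord0 /= expr0n mul1r mul0r !addr0.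
  (* The tangential gradient removes the normal part of the gradient of Q; the term [q1] [nu]
     restores it. *)
  have tgradQ : tgrad nu proj q z j 0 + q1 z * nu z j 0 = pdx j Q z.
    rewrite -/(pdtan nu proj j q z) (pdtan_eq mG uN tc delta0 j zS qQ).
    by rewrite (pdtan_ST mG uN tc delta0 j zS dQ) dnQ (mulrC (q1 z)) subrK.
  have := congr1 (fun M : vec R => M j 0) (ns_momentum ns1 zN1).
  rewrite /= !addE !scaleE -[in X in _ -> X]addrA tgradQ.
  have sv k : smooth_on (closure ST) (fun w => v w k 0) := sg 0 k.
  rewrite (material_derivative_ST mG uN nV tc delta0 CU UVN vU j zS sv).
  have tdE := tdivm_ST mG uN tc delta0 CU slip divU vU j zS.
  rewrite (mulrC 2) -(mulrA mu0 2) tdE.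
  have du : differentiable (u (eps0 / 2)) z.
    have [W [oW cW /(_ 1%N) [du _]]] := su _ eps1P.
    exact/du/cW/subset_closure.
  have pdtE : pdt (u (eps0 / 2)) z j 0 = pdt (U j) z.
    by rewrite /pdt (derive_entry _ _ _ du); exact: (agree_u j [:: None]).
  have advE : advect (u (eps0 / 2) z) (u (eps0 / 2)) z j 0 =
      \sum_(i < 3) U i z * pdx i (U j) z.
    rewrite mxE; apply: eq_bigr => i _.
    congr (_ * _); first exact: (agree_u i [::] isT).
    exact: (agree_u j [:: Some i] isT).
  have lapE : laplacian (u (eps0 / 2)) z j 0 =
      \sum_(i < 3) pdx i (pdx i (U j)) z.
    rewrite mxE; apply: eq_bigr => i _.
    exact: (agree_u j [:: Some i; Some i] isT).
  have gradE : grad (p (eps0 / 2)) z j 0 = pdx j Q z by rewrite mxE.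
  by rewrite pdtE advE lapE gradE.
- by move=> z zS; exact: (tdiv_ST mG uN tc delta0 CU UVN divU vU zS).
Qed.
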